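(* Let $\mathtt z>0$ satisfy $\mathtt z\le \mathfrak g^2/4$, and suppose that conditions (I), (ED0), (L0) and (C) below hold with constants $\mathfrak a,\nu_0,\mathfrak g>0$ and $\delta_n(\mathtt r_0(\mathtt z))\ge 0$. Then $$\mathbf P\big(\widetilde\theta\notin\Theta_n(\mathtt z)\big)\le 2e^{-\mathtt z}+8.4\,e^{-\mathfrak g^2/4}.$$
   Context: Setting. Fix integers $d,p\ge1$, $n\ge1$, a bandwidth $h>0$ and a point $x_0\in\mathbb R^d$. Let $X_1,\dots,X_n$ be i.i.d. random vectors in $\mathbb R^d$ with Lebesgue density $f$. Let $K:\mathbb R^d\to[0,\infty)$ be a bounded measurable kernel vanishing outside $[-1,1]^d$, and let $\psi_0,\dots,\psi_{p-1}:[-1,1]^d\to\mathbb R$ be bounded measurable functions with $\psi_0\equiv1$, linearly independent on $\{K>0\}$; write $\Psi(t)=(\psi_0(t),\dots,\psi_{p-1}(t))^\top$ (extended by $0$ outside $[-1,1]^d$). Put $T_i=(X_i-x_0)/h$ and define the local log-likelihood $$L(\theta)=\sum_{i=1}^n K(T_i)\Psi(T_i)^\top\theta-nh^d\int_{[-1,1]^d}K(t)\exp(\Psi(t)^\top\theta)\,dt,\qquad \theta\in\mathbb R^p.$$ Let $\widetilde\theta=\arg\max_\theta L(\theta)$ (the maximum likelihood estimator) and $\theta^*=\arg\max_\theta \mathbf E L(\theta)$ (both assumed to exist). Define $D_n^2(\theta)=-\nabla^2\mathbf E L(\theta)=nh^d\int K(t)\Psi(t)\Psi(t)^\top e^{\Psi(t)^\top\theta}dt$,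 $D_n^2=D_n^2(\theta^* )$ with $D_n$ its symmetric positive definite square root, score vector $\xi=D_n^{-1}\nabla L(\theta^* )$, and $V_n^2=\mathrm{Var}(\nabla L(\theta^* ))$ (assumed positive definite). Set $\zeta(p,\mathtt z)=\mathfrak a\nu_0(\sqrt p+\sqrt{2\mathtt z})$, $\mathtt r_0(\mathtt z)=4\mathfrak a\nu_0(\sqrt p+\sqrt{2\mathtt z})$ and $\Theta_n(\mathtt z)=\{\theta:\|D_n(\theta-\theta^* )\|\le\mathtt r_0(\mathtt z)\}$. $\|\cdot\|$ is the Euclidean norm on vectors and operator norm on matrices; $\succeq$ is the Loewner order. Conditions. (I): $\mathfrak a^2D_n^2\succeq V_n^2$. (ED0): with $\boldsymbol\zeta=V_n^{-1}\nabla L(\theta^* )-\mathbf E V_n^{-1}\nabla L(\theta^* )$, for all nonzero $\gamma\in\mathbb R^p$ and all $|\lambda|\le\mathfrak g$, $\log\mathbf E\exp(\lambda\gamma^\top\boldsymbol\zeta/\|\gamma\|)\le\nu_0^2\lambda^2/2$. (L0): for all $\theta\in\Theta_n(\mathtt z)$, $\|I_p-D_n^{-1}D_n^2(\theta)D_n^{-1}\|\le\delta_n(\mathtt r_0(\mathtt z))$. (C): $\mathtt r_0(\mathtt z)\,(1-\delta_n(\mathtt r_0(\mathtt z)))\ge2\zeta(p,\mathtt z)$. *)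

(* Defs.v *)
From HB Require Import structures.
From mathcomp Require Import all_boot all_order all_algebra.
From mathcomp Require Import all_classical all_reals all_analysis.
Set Implicit Arguments. Unset Strict Implicit. Unset Printing Implicit Defensive.
Import Order.TTheory GRing.Theory Num.Theory.
Import numFieldNormedType.Exports.
Local Open Scope classical_set_scope.
Local Open Scope ring_scope.

Section Defs.
Variable R : realType.

(* Iterated integral w.r.t. one-dimensional Lebesgue measure; for non-negative
   measurable integrands this is the integral against d-dimensional Lebesgue
   measure (Tonelli). *)
Fixpoint leb_nnint (d : nat) : (d.-tuple R -> \bar R) -> \bar R :=
  match d return (d.-tuple R -> \bar R) -> \bar R with
  | 0 => fun g => g [tuple]
  | d'.+1 => fun g =>
      (\int[@lebesgue_measure R]_x leb_nnint (fun t : d'.-tuple R => g [tuple of x :: t]))%E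
  end.

(* Lebesgue integral over R^d of a real function: positive part minus
   negative part (used only for bounded compactly supported integrands). *)
Definition leb_int (d : nat) (g : d.-tuple R -> R) : R :=
  fine (leb_nnint (fun t => (Num.max (g t) 0)%:E))
  - fine (leb_nnint (fun t => (Num.max (- g t) 0)%:E)).

Definition cube (d : nat) : set (d.-tuple R) :=
  [set t | forall j : 'I_d, -1 <= tnth t j <= 1].

Definition enorm (p : nat) (v : 'cV[R]_p) : R := Num.sqrt (\sum_j (v j 0) ^+ 2).
Definition opnorm (m p : nat) (M : 'M[R]_(m, p)) : R :=
  sup [set enorm (M *m v) | v in [set v : 'cV[R]_p | enorm v <= 1]].

Definition qform (p : nat) (A : 'M[R]_p) (v : 'cV[R]_p) : R := (v^T *m A *m v) 0 0.
Definition loewner_ge (p : nat) (A B : 'M[R]_p) : Prop :=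
  forall v : 'cV[R]_p, qform B v <= qform A v.
Definition sym_pd (p : nat) (A : 'M[R]_p) : Prop :=
  A^T = A /\ forall v : 'cV[R]_p, v != 0 -> 0 < qform A v.

Definition psi_dot (d p : nat) (psi : 'I_p -> d.-tuple R -> R)
  (t : d.-tuple R) (th : 'cV[R]_p) : R := \sum_j psi j t * th j 0.

Definition rescale (d : nat) (x0 : d.-tuple R) (h : R) (x : d.-tuple R)
  : d.-tuple R := [tuple (tnth x j - tnth x0 j) / h | j < d].

Definition loglik (d p n : nat) (K : d.-tuple R -> R) (psi : 'I_p -> d.-tuple R -> R)
  (x0 : d.-tuple R) (h : R) (x : 'I_n -> d.-tuple R) (th : 'cV[R]_p) : R :=
  \sum_i K (rescale x0 h (x i)) * psi_dot psi (rescale x0 h (x i)) th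
  - n%:R * h ^+ d * leb_int (fun t => K t * expR (psi_dot psi t th)).

Definition loglik_grad (d p n : nat) (K : d.-tuple R -> R) (psi : 'I_p -> d.-tuple R -> R)
  (x0 : d.-tuple R) (h : R) (x : 'I_n -> d.-tuple R) (th : 'cV[R]_p) : 'cV[R]_p :=
  \col_j (\sum_i K (rescale x0 h (x i)) * psi j (rescale x0 h (x i))
          - n%:R * h ^+ d * leb_int (fun t => K t * psi j t * expR (psi_dot psi t th))).

Definition Dn2 (d p n : nat) (K : d.-tuple R -> R) (psi : 'I_p -> d.-tuple R -> R)
  (h : R) (th : 'cV[R]_p) : 'M[R]_p :=
  \matrix_(j, k) (n%:R * h ^+ d *
     leb_int (fun t => K t * psi j t * psi k t * expR (psi_dot psi t th))).

End Defs.

Section Prob.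
Context {R : realType} {dO : measure_display} {Omega : measurableType dO}.
Variable P : probability Omega R.

Definition Ex (Y : Omega -> R) : R := fine (\int[P]_w (Y w)%:E)%E.
Definition Exv (p : nat) (Y : Omega -> 'cV[R]_p) : 'cV[R]_p :=
  \col_j Ex (fun w => Y w j 0).
Definition covmx (p : nat) (Y : Omega -> 'cV[R]_p) : 'M[R]_p :=
  \matrix_(j, k) Ex (fun w => (Y w j 0 - Exv Y j 0) * (Y w k 0 - Exv Y k 0)).

Definition mutually_independent {dT : measure_display} {T : measurableType dT}
  (n : nat) (X : 'I_n -> Omega -> T) : Prop :=
  forall A : 'I_n -> set T, (forall i, measurable (A i)) ->
    fine (P (\bigcap_(i in [set: 'I_n]) (X i @^-1` A i)))
    = \prod_i fine (P (X i @^-1` A i)).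
End Prob.

(* Main.v *)
(* Write ths for the target. If the estimator leaves the ellipsoid then, L being
   concave, there is v with |Dn v| = r0 and L(ths + v) >= L(ths). Integrating
     e^t - 1 - t >= (2/3) t^2 - (1/6) t^2 e^(-t),   t = Psi^T v,
   gives grad L(ths) . v >= (2/3) v^T Dn2(ths) v - (1/6) v^T Dn2(ths - v) v.
   As (C) forces delta <= 1/2, (L0) at ths - v makes the right-hand side at least
   (5/12) r0^2, and (I) yields |zeta_v| >= (5/3) nu0 (sqrt p + sqrt (2 z)).
   The factor 5/3, which Dn2(theta) >= (1 - delta) Dn2 alone does not give, leaves
   room for a tail bound needing no relation between g and p: average the moment
   bound over a nearly Gaussian vector truncated to the ball of radius
   2 sqrt z <= g, built as a scaled sum of random signs so that only finite sums
   are exchanged with the expectation. Truncation costs a factor 1/2, by Markov's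
   inequality for the second moment under the exponential tilt, and the resulting
   bound is 2 e^(-z). Applying it to zeta_v / nu0 with radius g requires
   nu0 >= 1, which holds because zeta_v has covariance I. *)
Require Import Defs.
From HB Require Import structures.
From mathcomp Require Import all_boot all_order all_algebra.
From mathcomp Require Import all_classical all_reals all_analysis.
From mathcomp Require Import measurable_realfun ring lra.
Set Implicit Arguments. Unset Strict Implicit. Unset Printing Implicit Defensive.
Import Order.TTheory GRing.Theory Num.Theory.
Import numFieldNormedType.Exports.
Local Open Scope classical_set_scope.
Local Open Scope ring_scope.

(** * Calculus inequalities for exp, cosh and sinh *)

Section RealExp.
Variable R : realType.
Implicit Types x y t : R.

Lemma le_of_derive_ge0 (f df : R -> R) (x : R) :
  (forall y, is_derive y (1 : R) f (df y)) -> (forall y, 0 <= y -> 0 <= df y) ->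
  0 <= x -> f 0 <= f x.
Proof.
move=> fdf df0; rewrite le_eqVlt => /predU1P[<-//|x0].
have [|c /itvP cx e] := @MVT R f df 0 x x0 (fun y _ => fdf y).
  by apply: derivable_within_continuous => y _; have [] := fdf y.
by rewrite -subr_ge0 e subr0 mulr_ge0 ?df0 ?cx// ltW.
Qed.

Definition ch x : R := (expR x + expR (- x)) / 2.
Definition sh x : R := (expR x - expR (- x)) / 2.

Lemma is_derive_ch x : is_derive x (1 : R) ch (sh x).
Proof.
rewrite /ch; apply: is_derive_eq; rewrite /sh /GRing.scale/=; ring.
Qed.

Lemma is_derive_sh x : is_derive x (1 : R) sh (ch x).
Proof.
rewrite /sh; apply: is_derive_eq; rewrite /ch /GRing.scale/=; ring.
Qed.
#[local] Existing Instance is_derive_ch.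
#[local] Existing Instance is_derive_sh.

Lemma chN x : ch (- x) = ch x.
Proof. by rewrite /ch opprK addrC. Qed.

Lemma ch_norm x : ch `|x| = ch x.
Proof. by case: (ger0P x) => // _; rewrite chN. Qed.

Lemma ch_gt0 x : 0 < ch x.
Proof. by rewrite divr_gt0// addr_gt0// expR_gt0. Qed.

Lemma sh_ge0 x : 0 <= x -> 0 <= sh x.
Proof. by move=> x0; rewrite divr_ge0// subr_ge0 ler_expR; lra. Qed.

Lemma sh0 : sh 0 = 0.
Proof. by rewrite /sh oppr0 subrr mul0r. Qed.

Lemma ch0 : ch 0 = 1.
Proof. by rewrite /ch oppr0 expR0; field. Qed.

Lemma ch_ge_quad x : 1 + x ^+ 2 / 2 <= ch x.
Proof.
wlog x0 : x / 0 <= x.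
  by move=> H; have := H `|x| (normr_ge0 _); rewrite ch_norm real_normK ?num_real.
have ch1 y : 0 <= y -> 1 <= ch y.
  by move=> y0; rewrite -ch0; apply: (@le_of_derive_ge0 ch sh) => // z; exact: sh_ge0.
have shy y : 0 <= y -> 0 <= sh y - y.
  move=> y0; have := @le_of_derive_ge0 (fun y => sh y - y) (fun y => ch y - 1) y.
  rewrite sh0 subr0; apply=> // z z0; by rewrite subr_ge0 ch1.
have := @le_of_derive_ge0 (fun y => ch y - y ^+ 2 / 2) (fun y => sh y - y) x.
rewrite ch0 expr0n/= mul0r subr0 lerBrDr; apply=> // y.
by apply: is_derive_eq; rewrite /GRing.scale/=; field.
Qed.

Lemma sh_le x : 0 <= x -> sh x <= x * ch x.
Proof.
move=> x0.
have := @le_of_derive_ge0 (fun y => y * ch y - sh y) (fun y => y * sh y) x.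
rewrite sh0 mul0r subrr subr_ge0; apply=> // y.
  by apply: is_derive_eq; rewrite /GRing.scale/=; ring.
by move=> y0; rewrite mulr_ge0// sh_ge0.
Qed.

Lemma sqr_sh_le x : sh x ^+ 2 <= x ^+ 2 * ch x ^+ 2.
Proof.
wlog x0 : x / 0 <= x.
  move=> H; have [/H//|x0] := leP 0 x.
  have := H (- x); rewrite chN sqrrN {1}/sh opprK oppr_ge0 => /(_ (ltW x0)).
  by rewrite -opprB mulNr sqrrN.
by rewrite -exprMn lerXn2r ?nnegrE ?sh_le ?sh_ge0// mulr_ge0// ltW ?ch_gt0.
Qed.

(** This bounds the moment generating function of one random sign by a Gaussian one:
    [e^(-y^2/2) ch y] decreases on [y >= 0], since its derivative has the sign of
    [sh y - y ch y]. *)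
Lemma ch_le_expR x : ch x <= expR (x ^+ 2 / 2).
Proof.
wlog x0 : x / 0 <= x.
  by move=> H; have := H `|x| (normr_ge0 _); rewrite ch_norm real_normK ?num_real.
have := @le_of_derive_ge0 (fun y => - (expR (- (y ^+ 2 / 2)) * ch y))
  (fun y => expR (- (y ^+ 2 / 2)) * (y * ch y - sh y)) x.
rewrite ch0 expr0n/= mul0r oppr0 expR0 mulr1 lerN2 expRN.
rewrite mulrC ler_pdivrMr ?expR_gt0// mul1r; apply=> // y.
  by apply: is_derive_eq; rewrite /GRing.scale/=; field.
by move=> y0; rewrite mulr_ge0 ?expR_ge0// subr_ge0 sh_le.
Qed.

Lemma ch_mono x y : `|x| <= `|y| -> ch x <= ch y.
Proof.
rewrite -[ch x]ch_norm -[ch y]ch_norm.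
have := normr_ge0 x; move: `|x| `|y| => {}x {}y x0 xy.
have h : expR x <= expR y by rewrite ler_expR.
have h1 : 1 <= expR x by have := expR_ge1Dx x; lra.
have h2 : 1 <= expR y by have := expR_ge1Dx y; lra.
rewrite /ch !expRN ler_pM2r; last by lra.
rewrite -subr_ge0.
(* The factorisation shows that [b + 1/b] increases on [b >= 1]. *)
have -> : expR y + (expR y)^-1 - (expR x + (expR x)^-1) =
   (expR y - expR x) * (1 - (expR x * expR y)^-1).
  by field; rewrite ?gt_eqF ?expR_gt0.
rewrite mulr_ge0 ?subr_ge0// invf_le1; nra.
Qed.

(** From [e^(-(t - t^2)) >= 1 - t + t^2] it remains to see that
    [(1 + t)(1 - t + t^2) = 1 + t^3 >= 1]. *)
Lemma expR_sub_sqr_le t : 0 <= t -> expR (t - t ^+ 2) <= 1 + t.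
Proof.
move=> t0; have := expR_ge1Dx (- (t - t ^+ 2)); rewrite expRN => h.
have p : 0 < 1 + - (t - t ^+ 2) by nra.
rewrite -[expR _]invrK; apply: (@le_trans _ _ (1 + - (t - t ^+ 2))^-1).
  by rewrite lef_pV2// posrE invr_gt0 expR_gt0.
by rewrite -[X in X <= _]mul1r ler_pdivrMr//; nra.
Qed.

(* With H(t) = x^2 e^(tx), log-convexity gives the affine minorant
   H(t) >= H(0) + t (H(0) - H(-1)); integrate it twice over [0, 1]. *)
Lemma expR_taylor2_ge x :
  x ^+ 2 * (2 / 3) - x ^+ 2 * expR (- x) / 6 <= expR x - 1 - x.
Proof.
(* [F' = F1], and [F1'] is [H] minus its affine minorant. As [F 0 = 1], the claim is
   [F 0 <= F 1]. *)
pose F1 t := x * expR (t * x) - x - x ^+ 2 * (t + t ^+ 2 / 2 * (1 - expR (- x))).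
pose F t := expR (t * x) - t * x - x ^+ 2 * (t ^+ 2 / 2 + t ^+ 3 / 6 * (1 - expR (- x))).
have dF1 y : 0 <= y -> 0 <= F1 y.
  move=> y0; have := @le_of_derive_ge0 F1
    (fun t => x ^+ 2 * (expR (t * x) - (1 + t * (1 - expR (- x))))) y.
  have -> : F1 0 = 0 by rewrite /F1 mul0r expR0 expr0n/=; ring.
  apply=> // t.
    by rewrite /F1; apply: is_derive_eq; rewrite /GRing.scale/=; field.
  move=> t0; rewrite mulr_ge0 ?sqr_ge0// subr_ge0.
  (* The minorant follows from [e^(tx) >= 1 + tx] and [x >= 1 - e^(-x)]. *)
  have := expR_ge1Dx (t * x); have := expR_ge1Dx (- x); nra.
have := @le_of_derive_ge0 F F1 1.
rewrite /F !mul0r expR0 !expr0n/= !expr1n !mul1r => H.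
have : 1 - 0 - x ^+ 2 * (0 / 2 + 0 / 6 * (1 - expR (- x))) <=
       expR x - x - x ^+ 2 * (2^-1 + 6^-1 * (1 - expR (- x))).
  apply: H => // y.
  by rewrite /F1; apply: is_derive_eq; rewrite /GRing.scale/=; field.
nra.
Qed.

End RealExp.

(** * Exponential moments of a sum of random signs *)

Fixpoint signs (M : nat) : finType :=
  if M is M'.+1 then (bool * signs M')%type else unit.

Section Rademacher.
Variable R : realType.
Implicit Types (M : nat) (f : R -> R) (t : R).

Fixpoint sign_sum M : signs M -> R :=
  match M return signs M -> R with
  | 0 => fun=> 0
  | M'.+1 => fun e => sign_sum e.2 + (-1) ^+ e.1
  end.

(* Expectation of f at the sum of M independent uniform signs. *)
Definition rad M f : R := \sum_(e : signs M) 2^-1 ^+ M * f (sign_sum e).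

Lemma rad0 f : rad 0 f = f 0.
Proof. by rewrite /rad (big_pred1 tt) ?expr0 ?mul1r// => -[]. Qed.

(** Conditioning on one sign. The nested pairs in [signs] reduce the split to [pair_bigA], and the
    moments below follow by induction on [M]. *)
Lemma radS M f : rad M.+1 f = rad M (fun x => (f (x + 1) + f (x - 1)) / 2).
Proof.
rewrite /rad -(pair_bigA _ (fun b (e : signs M) =>
  2^-1 ^+ M.+1 * f (sign_sum e + (-1) ^+ nat_of_bool b)))/= big_bool/= -big_split/=.
by apply: eq_bigr => e _; rewrite expr1 expr0 exprS; ring.
Qed.

Lemma le_rad M f f' : (forall x, f x <= f' x) -> rad M f <= rad M f'.
Proof. by move=> ff'; apply: ler_sum => e _; rewrite ler_wpM2l// exprn_ge0. Qed.

Lemma eq_rad M f f' : (forall x, f x = f' x) -> rad M f = rad M f'.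
Proof. by move=> ff'; apply: eq_bigr => e _; rewrite ff'. Qed.

Lemma radD M f f' : rad M (fun x => f x + f' x) = rad M f + rad M f'.
Proof. by rewrite -big_split; apply: eq_bigr => e _; rewrite mulrDr. Qed.

Lemma radZ M k f : rad M (fun x => k * f x) = k * rad M f.
Proof. by rewrite /rad mulr_sumr; apply: eq_bigr => e _; rewrite mulrCA. Qed.

Let expE t x b : expR (t * (x + b)) = expR (t * b) * expR (t * x).
Proof. by rewrite mulrDr expRD mulrC. Qed.

Lemma rad_expR M t : rad M (fun x => expR (t * x)) = ch t ^+ M.
Proof.
elim: M => [|M IH]; first by rewrite rad0 mulr0 expR0.
rewrite radS exprS -IH -radZ; apply: eq_rad => x.
by rewrite !expE mulr1 mulrN1 /ch; field.
Qed.

(** The derivative of [rad_expR] in [t]; the factor [ch t] on the left avoids the exponent [M - 1],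
    so that [M = 0] is no exception. *)
Lemma rad_id_expR M t :
  ch t * rad M (fun x => x * expR (t * x)) = M%:R * (sh t * ch t ^+ M).
Proof.
elim: M => [|M IH]; first by rewrite rad0 mul0r mulr0 mul0r.
have -> : rad M.+1 (fun x => x * expR (t * x)) =
    ch t * rad M (fun x => x * expR (t * x)) + sh t * ch t ^+ M.
  rewrite -rad_expR -!radZ -radD radS; apply: eq_rad => x.
  by rewrite !expE mulr1 mulrN1 /ch /sh; field.
by rewrite IH exprS -natr1; ring.
Qed.

(** The second derivative of [rad_expR], cleared of the exponent [M - 2]. *)
Lemma rad_sqr_expR M t :
  ch t ^+ 2 * rad M (fun x => x ^+ 2 * expR (t * x)) =
  (M%:R * ch t ^+ 2 + M%:R * (M%:R - 1) * sh t ^+ 2) * ch t ^+ M.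
Proof.
elim: M => [|M IH]; first by rewrite rad0 expr0n/= !mul0r mulr0 add0r mul0r.
have -> : rad M.+1 (fun x => x ^+ 2 * expR (t * x)) =
    ch t * (rad M (fun x => x ^+ 2 * expR (t * x)) + ch t ^+ M) +
    2 * sh t * rad M (fun x => x * expR (t * x)).
  rewrite -rad_expR -radD -!radZ -radD radS; apply: eq_rad => x.
  by rewrite !expE mulr1 mulrN1 /ch /sh; field.
have -> : forall a b, ch t ^+ 2 * (ch t * (a + ch t ^+ M) + 2 * sh t * b) =
  ch t * (ch t ^+ 2 * a) + ch t ^+ 3 * ch t ^+ M + 2 * sh t * ch t * (ch t * b).
  by move=> a b; ring.
by rewrite IH rad_id_expR [ch t ^+ M.+1]exprS -natr1; ring.
Qed.

(** Follows from [sh^2 <= t^2 ch^2]. Divided by [ch t ^+ M], this is the second moment under the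
    exponential tilt, needed for Markov's inequality in the truncation. *)
Lemma rad_sqr_expR_le M t :
  rad M (fun x => x ^+ 2 * expR (t * x)) <=
  (M%:R + M%:R ^+ 2 * t ^+ 2) * ch t ^+ M.
Proof.
have c0 := ch_gt0 t; rewrite -(ler_pM2l (exprn_gt0 2 c0)) rad_sqr_expR.
rewrite [X in _ <= X]mulrA; apply: ler_wpM2r; first by rewrite exprn_ge0 ?ltW.
have := sqr_sh_le t; have := sqr_ge0 (sh t); have := ler0n R M.
move: (sh t ^+ 2) (ch t ^+ 2) (t ^+ 2) M%:R => H C T m m0 H0 HT.
have : m ^+ 2 * H <= m ^+ 2 * (T * C) by rewrite ler_wpM2l// sqr_ge0.
nra.
Qed.

(** Integrating out one sign replaces [A] by [A - 1] at the cost of a factor [e^(1/(2A))], while the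
    denominator [A - M] keeps its value along the induction. *)
Lemma rad_expR_sqr_le M (A : R) : M%:R < A ->
  rad M (fun x => expR (x ^+ 2 / (2 * A))) <= expR (M%:R / (2 * (A - M%:R))).
Proof.
elim: M A => [|M IH] A MA; first by rewrite rad0 expr0n/= !mul0r.
have m0 := ler0n R M.
have A1 : M%:R < A - 1 by move: MA; rewrite -natr1; lra.
have step x : (expR ((x + 1) ^+ 2 / (2 * A)) + expR ((x - 1) ^+ 2 / (2 * A))) / 2 <=
    expR ((2 * A)^-1) * expR (x ^+ 2 / (2 * (A - 1))).
  have -> : (expR ((x + 1) ^+ 2 / (2 * A)) + expR ((x - 1) ^+ 2 / (2 * A))) / 2 =
      expR ((2 * A)^-1) * expR (x ^+ 2 / (2 * A)) * ch (x / A).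
    rewrite /ch mulrA mulrDr -!expRD; congr ((expR _ + expR _) / 2).
      by field; lra.
    by field; lra.
  rewrite -mulrA ler_wpM2l ?expR_ge0//.
  (* The bound [ch (x/A) <= e^(x^2/(2A^2))] is used with [1/A + 1/A^2 <= 1/(A - 1)]. *)
  apply: (le_trans (ler_wpM2l (expR_ge0 _) (ch_le_expR _))).
  rewrite -expRD ler_expR.
  have -> : x ^+ 2 / (2 * A) + (x / A) ^+ 2 / 2 = x ^+ 2 / 2 * (A^-1 + A^-1 ^+ 2).
    by field; lra.
  have -> : x ^+ 2 / (2 * (A - 1)) = x ^+ 2 / 2 * (A - 1)^-1 by field; lra.
  apply: ler_wpM2l; first by rewrite mulr_ge0 ?sqr_ge0.
  have A0 : 0 < A - 1 by lra.
  rewrite -[X in _ <= X]mul1r ler_pdivlMr//.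
  have AA : A * A^-1 = 1 by rewrite divff//; lra.
  have : 0 < A^-1 by rewrite invr_gt0; lra.
  move: (A^-1) AA => B AB B0; nra.
rewrite radS; apply: (@le_trans _ _
  (rad M (fun x => expR ((2 * A)^-1) * expR (x ^+ 2 / (2 * (A - 1)))))).
  exact: le_rad.
rewrite radZ.
apply: (le_trans (ler_wpM2l (expR_ge0 _) (IH _ A1))).
rewrite -expRD ler_expR -[M.+1%:R]natr1.
have -> : A - (M%:R + 1) = A - 1 - M%:R by ring.
(* Since [D <= A], the cost [1/(2A)] of the last sign is at most [1/(2D)]. *)
set D := A - 1 - M%:R; have D0 : 0 < D by rewrite /D; lra.
have -> : (M%:R + 1) / (2 * D) = (2 * D)^-1 + M%:R / (2 * D) by field; lra.
by rewrite lerD2r lef_pV2 ?posrE; rewrite /D; lra.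
Qed.

(** [ch_ge_quad] and [expR_sub_sqr_le], raised to the power [M]. For [t] of order [1/sqrt M] the
    quartic loss vanishes as [M] grows. *)
Lemma ch_pow_ge M t : expR (M%:R * (t ^+ 2 / 2 - (t ^+ 2 / 2) ^+ 2)) <= ch t ^+ M.
Proof.
rewrite expRM_natl lerXn2r ?nnegrE ?expR_ge0 ?(ltW (ch_gt0 _))//.
apply: le_trans (ch_ge_quad t); apply: expR_sub_sqr_le.
by rewrite mulr_ge0 ?sqr_ge0.
Qed.

End Rademacher.

(** * Inner product and Euclidean norm of column vectors *)

Section Euclidean.
Variables (R : realType) (p : nat).
Implicit Types (u v w : 'cV[R]_p) (k : R).

Definition dot u v : R := \sum_j u j 0 * v j 0.

Lemma dotE u v : (u^T *m v) 0 0 = dot u v.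
Proof. by rewrite mxE; apply: eq_bigr => j _; rewrite mxE. Qed.

Lemma dotC u v : dot u v = dot v u.
Proof. by apply: eq_bigr => j _; rewrite mulrC. Qed.

Lemma dotDl u v w : dot (u + v) w = dot u w + dot v w.
Proof. by rewrite -big_split; apply: eq_bigr => j _; rewrite mxE mulrDl. Qed.

Lemma dotZl k u v : dot (k *: u) v = k * dot u v.
Proof. by rewrite /dot mulr_sumr; apply: eq_bigr => j _; rewrite mxE mulrA. Qed.

Lemma dotDr u v w : dot w (u + v) = dot w u + dot w v.
Proof. by rewrite dotC dotDl !(dotC w). Qed.

Lemma dotZr k u v : dot u (k *: v) = k * dot u v.
Proof. by rewrite dotC dotZl dotC. Qed.

Lemma dotNl u v : dot (- u) v = - dot u v.
Proof. by rewrite -scaleN1r dotZl mulN1r. Qed.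

Lemma dot0l v : dot 0 v = 0.
Proof. by rewrite /dot big1// => j _; rewrite mxE mul0r. Qed.

Lemma dot_mulmx (A : 'M[R]_p) u v : dot u (A *m v) = dot (A^T *m u) v.
Proof. by rewrite -!dotE trmx_mul trmxK mulmxA. Qed.

Lemma qformE (A : 'M[R]_p) v : qform A v = dot v (A *m v).
Proof. by rewrite /qform -mulmxA dotE. Qed.

Lemma enorm_ge0 v : 0 <= enorm v.
Proof. exact: sqrtr_ge0. Qed.

Lemma enorm_sqr v : enorm v ^+ 2 = dot v v.
Proof.
rewrite sqr_sqrtr; last by apply: sumr_ge0 => j _; exact: sqr_ge0.
by apply: eq_bigr => j _; rewrite expr2.
Qed.

Lemma dot_ge0 v : 0 <= dot v v.
Proof. by rewrite -enorm_sqr sqr_ge0. Qed.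

Lemma enorm0 : enorm (0 : 'cV[R]_p) = 0.
Proof. by apply/eqP; rewrite -sqrf_eq0 enorm_sqr dot0l. Qed.

Lemma enorm_eq0 v : (enorm v == 0) = (v == 0).
Proof.
apply/idP/eqP => [|->]; last by rewrite enorm0.
rewrite -sqrf_eq0 enorm_sqr => /eqP h; apply/colP => j; rewrite mxE.
have /(_ h j isT)/eqP := @psumr_eq0P R _ predT (fun j => v j 0 * v j 0) (fun j _ => sqr_ge0 (v j 0)).
by rewrite mulf_eq0 orbb => /eqP.
Qed.

Lemma enorm_gt0 v : (0 < enorm v) = (v != 0).
Proof. by rewrite lt_def enorm_ge0 andbT enorm_eq0. Qed.

Lemma enormZ k v : enorm (k *: v) = `|k| * enorm v.
Proof.
apply/eqP; rewrite -(@eqrXn2 _ 2) ?mulr_ge0 ?enorm_ge0//.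
by rewrite exprMn real_normK ?num_real// !enorm_sqr dotZl dotZr expr2 mulrA.
Qed.

(** Cauchy-Schwarz, by expanding the squared norm of [|v| u - |u| v]. *)
Lemma dot_le u v : dot u v <= enorm u * enorm v.
Proof.
have [->|u0] := eqVneq u 0; first by rewrite dot0l enorm0 mul0r.
have [->|v0] := eqVneq v 0; first by rewrite dotC dot0l enorm0 mulr0.
have := dot_ge0 (enorm v *: u - enorm u *: v).
rewrite -scaleNr dotDl !dotDr !(dotZl, dotZr) (dotC v u) -!enorm_sqr.
move: u0 v0; rewrite -!enorm_gt0; move: (enorm u) (enorm v) (dot u v) => a b c a0 b0.
have ab0 : 0 < a * b by rewrite mulr_gt0.
move=> h; have : 0 <= (a * b) * (a * b - c) by nra.
by rewrite pmulr_rge0// subr_ge0.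
Qed.

Lemma dot_abs_le u v : `|dot u v| <= enorm u * enorm v.
Proof.
rewrite ler_norml dot_le andbT lerNl -dotNl.
by rewrite (le_trans (dot_le _ _))// -scaleN1r enormZ normrN1 mul1r.
Qed.

End Euclidean.

(** * The finite mixture standing for a truncated Gaussian vector *)

Section Mixture.
Variable R : realType.

Section grid.
Variables (p M : nat) (eta : R).
Implicit Types (f : {ffun 'I_p -> signs M}) (u : 'cV[R]_p).

(** The uniform probability, kept as a product over coordinates so that sums over [f] factorise by
    [bigA_distr_bigA]. *)
Definition grid_weight f : R := \prod_(j < p) 2^-1 ^+ M.
Definition grid_vec f : 'cV[R]_p := \col_j (eta * sign_sum R (f j)).

Lemma grid_weight_ge0 f : 0 <= grid_weight f.
Proof. by rewrite prodr_ge0// => j _; rewrite exprn_ge0. Qed.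

Lemma grid_prod (F : 'I_p -> R -> R) :
  \sum_f grid_weight f * \prod_j F j (sign_sum R (f j)) = \prod_j rad M (F j).
Proof.
rewrite bigA_distr_bigA; apply: eq_bigr => f _.
by rewrite /grid_weight -big_split.
Qed.

Lemma expR_dot_grid f u :
  expR (dot (grid_vec f) u) = \prod_j expR (eta * u j 0 * sign_sum R (f j)).
Proof.
rewrite -expR_sum; congr expR; apply: eq_bigr => j _.
by rewrite mxE; ring.
Qed.

Lemma grid_expR u :
  \sum_f grid_weight f * expR (dot (grid_vec f) u) = \prod_j ch (eta * u j 0) ^+ M.
Proof.
transitivity (\prod_j rad M (fun x => expR (eta * u j 0 * x))).
  by rewrite -grid_prod; apply: eq_bigr => f _; rewrite expR_dot_grid.
by apply: eq_bigr => j _; rewrite rad_expR.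
Qed.

(** The squared norm is a sum over coordinates [i]; in the term of [i] only the factor of [i]
    changes, and [rad_sqr_expR_le] bounds it. *)
Lemma grid_sqr_expR_le u :
  \sum_f grid_weight f * (enorm (grid_vec f) ^+ 2 * expR (dot (grid_vec f) u)) <=
  (p%:R * (eta ^+ 2 * M%:R) + (eta ^+ 2 * M%:R) ^+ 2 * enorm u ^+ 2) *
  \prod_j ch (eta * u j 0) ^+ M.
Proof.
pose F i j x : R := (if j == i then eta ^+ 2 * x ^+ 2 else 1) * expR (eta * u j 0 * x).
have -> : \sum_f grid_weight f * (enorm (grid_vec f) ^+ 2 * expR (dot (grid_vec f) u)) =
    \sum_i \prod_j rad M (F i j).
  under [RHS]eq_bigr do rewrite -grid_prod.
  rewrite exchange_big/=; apply: eq_bigr => f _; rewrite -mulr_sumr; congr (_ * _).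
  rewrite expR_dot_grid enorm_sqr mulr_suml; apply: eq_bigr => i _.
  rewrite big_split/=; congr (_ * _).
  by rewrite -big_mkcond big_pred1_eq mxE; ring.
have -> : p%:R * (eta ^+ 2 * M%:R) + (eta ^+ 2 * M%:R) ^+ 2 * enorm u ^+ 2 =
    \sum_i (eta ^+ 2 * M%:R + (eta ^+ 2 * M%:R) ^+ 2 * u i 0 ^+ 2).
  by rewrite big_split/= sumr_const card_ord -mulr_sumr enorm_sqr mulr_natl.
rewrite mulr_suml; apply: ler_sum => i _.
rewrite [leLHS](bigD1 i)//= [in leRHS](bigD1 i)//=.
have -> : \prod_(j < p | j != i) rad M (F i j) =
    \prod_(j < p | j != i) ch (eta * u j 0) ^+ M.
  apply: eq_bigr => j /negbTE ji; rewrite -rad_expR; apply: eq_rad => x.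
  by rewrite /F ji mul1r.
rewrite mulrA ler_wpM2r ?prodr_ge0// => [j _|]; first by rewrite exprn_ge0// ltW// ch_gt0.
have -> : rad M (F i i) = eta ^+ 2 * rad M (fun x => x ^+ 2 * expR (eta * u i 0 * x)).
  by rewrite -radZ; apply: eq_rad => x; rewrite /F eqxx mulrA.
apply: (le_trans (ler_wpM2l (sqr_ge0 _) (rad_sqr_expR_le _ _))).
rewrite mulrA le_eqVlt; apply/orP; left; apply/eqP; congr (_ * _); ring.
Qed.

(** The coordinates are independent, and each one is [rad_expR_sqr_le] at [A = 1/eta^2]. *)
Lemma grid_expR_sqr_le : (0 < M)%N -> eta ^+ 2 * M%:R < 1 -> eta != 0 ->
  \sum_f grid_weight f * expR (enorm (grid_vec f) ^+ 2 / 2) <=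
  expR (p%:R * (eta ^+ 2 * M%:R) / (2 * (1 - eta ^+ 2 * M%:R))).
Proof.
move=> M0 s1 eta0; have e20 : 0 < eta ^+ 2 by rewrite exprn_even_gt0.
have -> : \sum_f grid_weight f * expR (enorm (grid_vec f) ^+ 2 / 2) =
   \prod_(j < p) rad M (fun x => expR (x ^+ 2 / (2 * (eta ^+ 2)^-1))).
  rewrite -grid_prod; apply: eq_bigr => f _; congr (_ * _).
  rewrite enorm_sqr /dot mulr_suml expR_sum; apply: eq_bigr => j _.
  by rewrite mxE; congr expR; field.
have MA : M%:R < (eta ^+ 2)^-1 by rewrite -[_^-1]mul1r ltr_pdivlMr// mulrC.
have -> : p%:R * (eta ^+ 2 * M%:R) / (2 * (1 - eta ^+ 2 * M%:R)) =
    \sum_(j < p) (M%:R / (2 * ((eta ^+ 2)^-1 - M%:R))) :> R.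
  rewrite sumr_const card_ord -[RHS]mulr_natl; field; rewrite eta0/=; lra.
rewrite expR_sum; apply: ler_prod => j _; rewrite rad_expR_sqr_le// andbT.
by apply: sumr_ge0 => e _; rewrite mulr_ge0 ?expR_ge0 ?exprn_ge0.
Qed.

(** The bounds [ch_pow_ge] are multiplied, and the sum of the [u_j^4] is at most [|u|^4]. With
    [eta^2 M = s] the loss is [s^2 |u|^4 / (4M)]. *)
Lemma prod_ch_ge (u : 'cV[R]_p) :
  expR (eta ^+ 2 * M%:R * enorm u ^+ 2 / 2 - eta ^+ 4 * M%:R * enorm u ^+ 4 / 4) <=
  \prod_j ch (eta * u j 0) ^+ M.
Proof.
apply: (@le_trans _ _ (\prod_j
    expR (M%:R * ((eta * u j 0) ^+ 2 / 2 - ((eta * u j 0) ^+ 2 / 2) ^+ 2)))); last first.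
  by apply: ler_prod => j _; rewrite expR_ge0 ch_pow_ge.
rewrite -expR_sum ler_expR.
have -> : enorm u ^+ 4 = (enorm u ^+ 2) ^+ 2 by rewrite -exprM.
have -> : enorm u ^+ 2 = \sum_j u j 0 ^+ 2.
  by rewrite enorm_sqr; apply: eq_bigr => j _; rewrite expr2.
have le4 : \sum_j (u j 0 ^+ 2) ^+ 2 <= (\sum_j u j 0 ^+ 2) ^+ 2.
  rewrite expr2 mulr_suml; apply: ler_sum => j _.
  rewrite expr2 ler_wpM2l ?sqr_ge0// (bigD1 j)//= lerDl sumr_ge0// => i _.
  exact: sqr_ge0.
have -> : \sum_j M%:R * ((eta * u j 0) ^+ 2 / 2 - ((eta * u j 0) ^+ 2 / 2) ^+ 2) =
   eta ^+ 2 * M%:R / 2 * (\sum_j u j 0 ^+ 2) - eta ^+ 4 * M%:R / 4 * \sum_j (u j 0 ^+ 2) ^+ 2.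
  rewrite !mulr_sumr -sumrB; apply: eq_bigr => j _; by field.
have K0 : 0 <= eta ^+ 4 * M%:R / 4 by rewrite divr_ge0// mulr_ge0// exprn_even_ge0.
have := ler_wpM2l K0 le4; lra.
Qed.

End grid.

(* A finitely supported surrogate of a centred Gaussian vector with covariance
   s I_p, truncated to the ball of radius G. *)
Lemma truncated_mixture (p : nat) (s T G eps : R) :
  0 < s < 1 -> 0 < T -> 0 < G -> 0 < eps -> p%:R * s + s ^+ 2 * T ^+ 2 <= G ^+ 2 / 2 ->
  exists (E : finType) (w : E -> R) (gam : E -> 'cV[R]_p),
  [/\ forall e, 0 <= w e, forall e, w e != 0 -> enorm (gam e) <= G,
    \sum_e w e * expR (enorm (gam e) ^+ 2 / 2) <= expR (p%:R * s / (2 * (1 - s))) &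
    forall u, T <= enorm u ->
      expR (s * T ^+ 2 / 2 - eps) / 2 <= \sum_e w e * expR (dot (gam e) u)].
Proof.
move=> /andP[s0 s1] T0 G0 eps0 sTG.
(* Large enough for the loss [s^2 T^4 / (4M)] of [prod_ch_ge] at [|u| = T] to be at most [eps]. *)
pose M := (Num.truncn (s ^+ 2 * T ^+ 4 / (4 * eps))).+1.
have M0 : 0 < M%:R :> R by rewrite ltr0n.
have MT : s ^+ 2 * T ^+ 4 / (4 * eps) < M%:R by exact: truncnS_gt.
pose eta := Num.sqrt (s / M%:R).
have eta0 : 0 < eta by rewrite sqrtr_gt0 divr_gt0.
have eta2 : eta ^+ 2 * M%:R = s.
  by rewrite sqr_sqrtr ?divr_ge0 ?ltW// divfK ?gt_eqF.
have eta4 : eta ^+ 4 * M%:R * T ^+ 4 / 4 <= eps.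
  have -> : eta ^+ 4 * M%:R = s ^+ 2 / M%:R.
    by rewrite -eta2; field; rewrite gt_eqF.
  move: MT; rewrite ltr_pdivrMr ?mulr_gt0// => MT.
  rewrite ler_pdivrMr// mulrAC ler_pdivrMr//; nra.
(* The boolean is a global sign: symmetrised, the mixture is a sum of terms [ch], monotone in
   [|dot gam u|], so that [|u| >= T] reduces to [|u| = T]. The mass outside the ball is dropped
   without renormalising. *)
pose E : finType := (bool * {ffun 'I_p -> signs M})%type.
pose in_ball (f : {ffun 'I_p -> signs M}) : R := ((enorm (grid_vec eta f) <= G)%R : nat)%:R.
pose w (e : E) : R := 2^-1 * (in_ball e.2 * grid_weight e.2).
pose gam (e : E) : 'cV[R]_p := (-1) ^+ e.1 *: grid_vec eta e.2.
have ball01 f : 0 <= in_ball f <= 1 by rewrite ler0n lern1; case: (_ <= _).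
have w0 e : 0 <= w e.
  by have /andP[? _] := ball01 e.2; rewrite !mulr_ge0// ?invr_ge0// grid_weight_ge0.
have normE e : enorm (gam e) = enorm (grid_vec eta e.2).
  by rewrite enormZ normrX normrN1 expr1n mul1r.
have sumE (F : 'cV[R]_p -> R) : \sum_e w e * F (gam e) =
   \sum_(f : {ffun 'I_p -> signs M}) in_ball f * grid_weight f * ((F (grid_vec eta f) + F (- grid_vec eta f)) / 2).
  rewrite -(pair_bigA _ (fun (b : bool) f => w (b, f) * F (gam (b, f))))/= big_bool/= -big_split.
  apply: eq_bigr => f _; rewrite /gam/= expr1 expr0 scale1r scaleN1r /w/=; by field.
have low (v : 'cV[R]_p) : enorm v = T ->
    expR (s * T ^+ 2 / 2 - eps) / 2 <=
    \sum_(f : {ffun 'I_p -> signs M}) in_ball f * grid_weight f * expR (dot (grid_vec eta f) v).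
  move=> vT; set C := \prod_j ch (eta * v j 0) ^+ M.
  have Cge : expR (s * T ^+ 2 / 2 - eps) <= C.
    apply: le_trans (prod_ch_ge M eta v); rewrite ler_expR vT eta2; lra.
  have C0 : 0 <= C by apply: le_trans Cge; exact: expR_ge0.
  apply: (@le_trans _ _ (C / 2)); first by rewrite ler_pM2r.
  have e1 := grid_expR M eta v; have e2 := grid_sqr_expR_le M eta v.
  rewrite eta2 vT -/C in e1 e2.
  have G2 : 0 < G ^+ 2 by rewrite exprn_gt0.
  (* Markov's inequality: the truncation loses at most [G^-2] times the tilted second moment, and by
     the hypothesis on [G] this is at most [C / 2]. *)
  have : C / 2 <= C - G ^- 2 * ((p%:R * s + s ^+ 2 * T ^+ 2) * C).
    have : G ^- 2 * ((p%:R * s + s ^+ 2 * T ^+ 2) * C) <= G ^- 2 * (G ^+ 2 / 2 * C).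
      by rewrite ler_wpM2l ?invr_ge0 ?(ltW G2)// ler_wpM2r.
    have -> : G ^- 2 * (G ^+ 2 / 2 * C) = C / 2 by field; rewrite gt_eqF.
    lra.
  move=> /le_trans; apply.
  apply: (@le_trans _ _ (\sum_(f : {ffun 'I_p -> signs M}) grid_weight f * expR (dot (grid_vec eta f) v) -
    G ^- 2 * \sum_(f : {ffun 'I_p -> signs M}) grid_weight f * (enorm (grid_vec eta f) ^+ 2 * expR (dot (grid_vec eta f) v)))).
    by rewrite e1 lerD2l lerN2 ler_wpM2l// invr_ge0 ltW.
  rewrite mulr_sumr -sumrB; apply: ler_sum => f _.
  have -> : forall a b c d : R, a * b - c * (a * (d * b)) = (1 - c * d) * (a * b).
    by move=> a b c d; ring.
  rewrite -mulrA; apply: ler_wpM2r; first by rewrite mulr_ge0 ?grid_weight_ge0 ?expR_ge0.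
  (* Termwise, the indicator of the ball is at least [1 - |gam|^2 / G^2]. *)
  rewrite /in_ball; case: (leP (enorm _) G) => [_|Gl]/=; rewrite ?mulr1n ?mulr0n.
    by rewrite gerBl mulr_ge0 ?invr_ge0 ?sqr_ge0.
  by rewrite subr_le0 mulrC ler_pdivlMr// mul1r lerXn2r ?nnegrE ?enorm_ge0 ?ltW.
exists E, w, gam; split => //.
- move=> e; rewrite /w normE /in_ball; case: (_ <= _) => //.
  by rewrite mul0r mulr0 eqxx.
- rewrite -[in leRHS]eta2.
  apply: le_trans (@grid_expR_sqr_le p M eta _ _ _) => //; rewrite ?eta2 ?gt_eqF//.
  rewrite (sumE (fun v => expR (enorm v ^+ 2 / 2))); apply: ler_sum => f _.
  rewrite -[- grid_vec eta f]scaleN1r enormZ normrN1 mul1r.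
  have /andP[b0 b1] := ball01 f.
  have -> : forall a : R, (a + a) / 2 = a by move=> a; field.
  by rewrite -mulrA ler_piMl// mulr_ge0 ?grid_weight_ge0 ?expR_ge0.
move=> u Tu; pose v := (T / enorm u) *: u.
have u0 : 0 < enorm u by exact: lt_le_trans Tu.
have vT : enorm v = T.
  by rewrite enormZ ger0_norm ?divr_ge0 ?(ltW T0) ?enorm_ge0// divfK ?gt_eqF.
apply: (@le_trans _ _ (\sum_e w e * expR (dot (gam e) v))).
  have NvT : enorm (- v) = T by rewrite -scaleN1r enormZ normrN1 mul1r.
  rewrite (sumE (fun z => expR (dot z v))).
  have -> : \sum_(f : {ffun 'I_p -> signs M}) in_ball f * grid_weight f *
      ((expR (dot (grid_vec eta f) v) + expR (dot (- grid_vec eta f) v)) / 2) =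
      (\sum_(f : {ffun 'I_p -> signs M}) in_ball f * grid_weight f * expR (dot (grid_vec eta f) v) +
      \sum_(f : {ffun 'I_p -> signs M}) in_ball f * grid_weight f * expR (dot (grid_vec eta f) (- v))) / 2.
    rewrite -big_split/= mulr_suml; apply: eq_bigr => f _.
    by rewrite dotNl (dotC _ (- v)) dotNl (dotC v); field.
  have := low _ vT; have := low _ NvT; lra.
rewrite (sumE (fun z => expR (dot z v))) (sumE (fun z => expR (dot z u))).
apply: ler_sum => f _; rewrite ler_wpM2l//.
  by have /andP[? _] := ball01 f; rewrite mulr_ge0// grid_weight_ge0.
rewrite !dotNl; apply: ch_mono.
rewrite dotZr normrM ler_piMl// ger0_norm ?divr_ge0 ?(ltW T0) ?enorm_ge0//.
by rewrite ler_pdivrMr// mul1r.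
Qed.

End Mixture.

(** * Tail bound for the norm of a subgaussian vector *)

Section Tail.
Context {R : realType} {dO : measure_display} {Omega : measurableType dO}.
Variable P : probability Omega R.

Lemma measurable_dot (p : nat) (u : 'cV[R]_p) (Z : Omega -> 'cV[R]_p) :
  (forall j, measurable_fun setT (fun w => Z w j 0)) ->
  measurable_fun setT (fun w => dot u (Z w)).
Proof.
move=> mZ; apply: measurable_sum => j.
exact: measurable_funM.
Qed.

(** Let [S] be the mixture of the [e^(gam . Z)]. The moment bound controls its mean because every
    [gam] of nonzero weight has norm at most [sqrt 2 * y]; [S] is large on [A], and Markov's
    inequality concludes. *)
Lemma subgaussian_norm_tail (p : nat) (Z : Omega -> 'cV[R]_p) (y : R) (A : set Omega) :
  (0 < p)%N -> 0 < y ->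
  (forall j, measurable_fun setT (fun w => Z w j 0)) ->
  (forall u, enorm u <= Num.sqrt 2 * y ->
    (\int[P]_w (expR (dot u (Z w)))%:E <= (expR (enorm u ^+ 2 / 2))%:E)%E) ->
  measurable A ->
  (forall w, A w -> 5 / 3 * (Num.sqrt p%:R + y) <= enorm (Z w)) ->
  (P A <= (2 * expR (- (y ^+ 2 / 2)))%:E)%E.
Proof.
move=> p0 y0 mZ mgf mA AZ.
set x : R := Num.sqrt p%:R; have x2 : x ^+ 2 = p%:R by rewrite sqr_sqrtr.
have x0 : 0 < x by rewrite sqrtr_gt0 ltr0n.
set T := 5 / 3 * (x + y) in AZ.
(* This choice gives [s T^2 = (5/3) y^2] and [p s = (3/5) (1 - q)^2 y^2], so that every exponent is
   controlled by a multiple of [y^2] whatever [p] is. *)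
pose q := y / (x + y); pose s := 3 / 5 * q ^+ 2.
have xy0 : 0 < x + y by rewrite addr_gt0.
have qxy : q * (x + y) = y by rewrite divfK ?gt_eqF.
have q0 : 0 < q by rewrite divr_gt0.
have q1 : q < 1 by rewrite ltr_pdivrMr// mul1r ltrDr.
have s0 : 0 < s by rewrite mulr_gt0 ?exprn_gt0//; lra.
have s1 : s < 1 by rewrite /s; nra.
have T0 : 0 < T by rewrite mulr_gt0//; lra.
have sT : s * T ^+ 2 = 5 / 3 * y ^+ 2 by rewrite -qxy /s /T; field.
have e2 : Num.sqrt 2 ^+ 2 = 2 :> R by rewrite sqr_sqrtr.
have qx : q * x = (1 - q) * y by rewrite mulrBl mul1r -{1}qxy; ring.
have ps : p%:R * s = 3 / 5 * ((1 - q) * y) ^+ 2 by rewrite -x2 -qx /s; ring.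
(* The slack [y^2 / 30] lowers the exponent [s T^2 / 2 = (5/6) y^2] to [(4/5) y^2]. *)
have [|||||E [w [gam [w0 wG wU wL]]]] :=
    @truncated_mixture R p s T (Num.sqrt 2 * y) (y ^+ 2 / 30).
- by rewrite s0.
- exact: T0.
- by rewrite mulr_gt0// sqrtr_gt0.
- by rewrite divr_gt0// exprn_gt0.
- have -> : s ^+ 2 * T ^+ 2 = q ^+ 2 * y ^+ 2 by rewrite expr2 -mulrA sT /s; field.
  rewrite ps [(Num.sqrt 2 * y) ^+ 2]exprMn e2 exprMn.
  have h : 3 / 5 * (1 - q) ^+ 2 + q ^+ 2 <= 1 by nra.
  have := ler_wpM2r (sqr_ge0 y) h; lra.
set S := fun v => \sum_e w e * expR (dot (gam e) (Z v)).
have mS : measurable_fun setT S.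
  apply: measurable_sum => e; apply: measurable_funM => //.
  by apply: measurableT_comp => //; exact: measurable_dot.
have S0 v : 0 <= S v by apply: sumr_ge0 => e _; rewrite mulr_ge0 ?expR_ge0.
have intS : (\int[P]_v (S v)%:E <= (expR (3 / 10 * y ^+ 2))%:E)%E.
  apply: (@le_trans _ _ (\sum_e w e * expR (enorm (gam e) ^+ 2 / 2))%:E); last first.
    rewrite lee_fin (le_trans wU)// ler_expR ps ler_pdivrMr; last by rewrite mulr_gt0// subr_gt0.
    (* Hence [p s / (2 (1 - s)) <= (3/10) y^2]. *)
    have : (1 - q) ^+ 2 <= 1 - s by rewrite /s; nra.
    have := sqr_ge0 y; rewrite exprMn; nra.
  under eq_integral do rewrite /S -sumEFin.
  rewrite ge0_integral_sum//; last 2 first.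
  - move=> e; apply/measurable_EFinP; apply: measurable_funM => //.
    by apply: measurableT_comp => //; exact: measurable_dot.
  - by move=> e v _; rewrite lee_fin mulr_ge0 ?expR_ge0.
  rewrite -sumEFin; apply: lee_sum => e _.
  under eq_integral do rewrite EFinM.
  have mE : measurable_fun setT (fun v => (expR (dot (gam e) (Z v)))%:E).
    apply/measurable_EFinP.
    by apply: measurableT_comp => //; exact: measurable_dot.
  rewrite ge0_integralZl_EFin//.
  have [->|we] := eqVneq (w e) 0; first by rewrite mul0r mul0e.
  by rewrite EFinM lee_wpmul2l ?lee_fin// mgf// wG.
pose B := expR (4 / 5 * y ^+ 2) / 2.
have BS v : A v -> B <= S v.
  move=> /AZ /wL; apply: le_trans; rewrite ler_pM2r// ler_expR sT; lra.
have B0 : 0 < B by rewrite divr_gt0// expR_gt0.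
have : (B%:E * P A <= (expR (3 / 10 * y ^+ 2))%:E)%E.
  apply: le_trans intS; have -> : (B%:E * P A = \int[P]_(v in A) B%:E)%E.
    by rewrite integral_cst.
  apply: (@le_trans _ _ (\int[P]_(v in A) (S v)%:E)%E).
    apply: ge0_le_integral => //.
    - by move=> v _; rewrite lee_fin ltW.
    - by apply/measurable_EFinP; exact: measurable_funTS.
  have mES : measurable_fun setT (fun v => (S v)%:E) by exact/measurable_EFinP.
  by apply: ge0_subset_integral => // v _; rewrite lee_fin.
rewrite muleC -lee_pdivlMr// => /le_trans; apply.
(* The exponents combine as [3/10 - 4/5 = -1/2]; the factor 2 is the price of the truncation. *)
rewrite lee_fin /B ler_pdivrMr ?divr_gt0 ?expR_gt0//.
have -> : 2 * expR (- (y ^+ 2 / 2)) * (expR (4 / 5 * y ^+ 2) / 2) =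
  expR (- (y ^+ 2 / 2) + 4 / 5 * y ^+ 2) by rewrite expRD; field.
by rewrite ler_expR; lra.
Qed.

End Tail.

(** * Linearity and monotonicity of the iterated Lebesgue integral *)

Section LebInt.
Variable R : realType.
Local Notation mu := (@lebesgue_measure R).

Lemma leb_nnint_ge0 (d : nat) (g : d.-tuple R -> \bar R) :
  (forall t, 0 <= g t)%E -> (0 <= leb_nnint g)%E.
Proof.
elim: d g => [|d IH] g g0 //=.
by apply: integral_ge0 => x _; exact: IH.
Qed.

(** The parameter space [T] is arbitrary because the induction on [d] moves one coordinate from the
    integration variable to the parameter; Tonelli's theorem integrates it out. *)
Lemma measurable_leb_nnint (d : nat) dT (T : measurableType dT) (g : T -> d.-tuple R -> \bar R) :
  (forall x t, 0 <= g x t)%E ->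
  measurable_fun setT (fun z : T * d.-tuple R => g z.1 z.2) ->
  measurable_fun setT (fun x => leb_nnint (g x)).
Proof.
elim: d dT T g => [|d IH] dT T g g0 mg /=.
  apply: (measurableT_comp mg (_ : measurable_fun setT (fun x => (x, [tuple])))).
  exact: measurable_fun_pair.
pose h (z : T * R) := leb_nnint (fun t : d.-tuple R => g z.1 [tuple of z.2 :: t]).
have mh : measurable_fun setT h.
  apply: IH => // .
  apply: (measurableT_comp mg (_ : measurable_fun setT
    (fun z : (T * R) * d.-tuple R => (z.1.1, [tuple of z.1.2 :: z.2])))).
  apply: measurable_fun_pair; first exact: measurableT_comp.
  by apply: measurable_cons => //; exact: measurableT_comp.
apply: (@measurable_fun_fubini_tonelli_F _ _ _ _ R mu h mh).
by move=> z; exact: leb_nnint_ge0.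
Qed.

Lemma measurable_cons_tuple (d : nat) (g : d.+1.-tuple R -> \bar R) x :
  measurable_fun setT g ->
  measurable_fun setT (fun t : d.-tuple R => g [tuple of x :: t]).
Proof. by move=> mg; apply: measurableT_comp => //; exact: measurable_cons. Qed.

Lemma measurable_leb_nnint_cons (d : nat) (g : d.+1.-tuple R -> \bar R) :
  (forall t, 0 <= g t)%E -> measurable_fun setT g ->
  measurable_fun setT (fun x : R => leb_nnint (fun t : d.-tuple R => g [tuple of x :: t])).
Proof.
move=> g0 mg; apply: measurable_leb_nnint => //.
by apply: measurableT_comp => //; apply: measurable_cons.
Qed.

Lemma leb_nnintD (d : nat) (g g' : d.-tuple R -> \bar R) :
  (forall t, 0 <= g t)%E -> (forall t, 0 <= g' t)%E ->
  measurable_fun setT g -> measurable_fun setT g' ->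
  (leb_nnint (fun t => g t + g' t) = leb_nnint g + leb_nnint g')%E.
Proof.
elim: d g g' => [|d IH] g g' g0 g'0 mg mg' //=.
rewrite -ge0_integralD//; last 4 first.
- by move=> x _; exact: leb_nnint_ge0.
- exact: measurable_leb_nnint_cons.
- by move=> x _; exact: leb_nnint_ge0.
- exact: measurable_leb_nnint_cons.
apply: eq_integral => x _; rewrite -IH//; exact: measurable_cons_tuple.
Qed.

Lemma leb_nnintZ (d : nat) (g : d.-tuple R -> \bar R) (k : R) :
  0 <= k -> (forall t, 0 <= g t)%E -> measurable_fun setT g ->
  (leb_nnint (fun t => k%:E * g t) = k%:E * leb_nnint g)%E.
Proof.
move=> k0; elim: d g => [|d IH] g g0 mg //=.
rewrite -ge0_integralZl_EFin//; last 2 first.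
- by move=> x _; exact: leb_nnint_ge0.
- exact: measurable_leb_nnint_cons.
apply: eq_integral => x _; rewrite -IH//; exact: measurable_cons_tuple.
Qed.

Lemma leb_nnint_cube_le (d : nat) (g : d.-tuple R -> \bar R) (M : R) :
  0 <= M -> (forall t, 0 <= g t <= M%:E)%E -> measurable_fun setT g ->
  (forall t, ~ cube t -> g t = 0%E) -> (leb_nnint g <= (2 ^+ d * M)%:E)%E.
Proof.
elim: d g M => [|d IH] g M M0 gM mg gc /=.
  by rewrite expr0 mul1r; have /andP[] := gM [tuple].
have g0 t : (0 <= g t)%E by have /andP[] := gM t.
pose I : set R := `[-1, 1]%classic.
have mI : measurable (I : set R) by exact: measurable_itv.
apply: (@le_trans _ _ (\int[mu]_x ((2 ^+ d * M)%:E * (\1_I x)%:E))%E).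
  apply: ge0_le_integral => //.
  - by move=> x _; exact: leb_nnint_ge0.
  - exact: measurable_leb_nnint_cons.
  - by apply: measurable_funeM; apply/measurable_EFinP; exact: measurable_indic.
  - move=> x _; rewrite indicE; have [xI|xI] := boolP (x \in I).
      rewrite mule1; apply: IH => //; first exact: measurable_cons_tuple.
      move=> t ct; apply: gc => cxt; apply: ct => j.
      by have := cxt (lift ord0 j); rewrite tnthS.
    (* Off [I] the section of [g] vanishes, so the induction hypothesis applies with bound 0. *)
    rewrite mule0 -[X in (_ <= X)%E](_ : (2 ^+ d * 0)%:E = 0%E); last by rewrite mulr0.
    have gx (t : d.-tuple R) : g [tuple of (x : R) :: t] = 0%E.
      apply: gc => /(_ ord0); rewrite tnth0 => xx; move: xI.
      by rewrite notin_setE /I/= in_itv/=.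
    apply: IH => //; first by move=> t; rewrite gx lexx.
    exact: measurable_cons_tuple.
rewrite ge0_integralZl_EFin//; last 2 first.
- by apply/measurable_EFinP; exact: measurable_indic.
- by rewrite mulr_ge0// exprn_ge0.
have muI : mu I = 2%:E by rewrite lebesgue_measure_itv/= lte_fin ifT; [rewrite -EFinB; congr EFin|]; lra.
rewrite integral_indic// setIT -[X in (_ * X)%E]/(mu I) muI.
by rewrite -EFinM lee_fin exprS; lra.
Qed.

Section cube_bounded.
Variable d : nat.
Implicit Types g : d.-tuple R -> R.

(** A class on which both parts of [leb_int] are finite, so that [fine] loses nothing. *)
Definition cube_bounded g : Prop :=
  [/\ measurable_fun setT g, forall t, ~ cube t -> g t = 0 &
      exists M, forall t, `|g t| <= M].

Let nnI g : R := fine (leb_nnint (fun t => (g t)%:E)).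

Let nnI_fin g : cube_bounded g -> (forall t, 0 <= g t) ->
  leb_nnint (fun t => (g t)%:E) \is a fin_num.
Proof.
move=> [mg gc [M gM]] g0; rewrite ge0_fin_numE; last by apply: leb_nnint_ge0 => t; rewrite lee_fin.
apply: (@le_lt_trans _ _ (2 ^+ d * M)%:E); last exact: ltry.
apply: leb_nnint_cube_le.
- exact: le_trans (gM [tuple 0 | _ < d]).
- by move=> t; rewrite !lee_fin g0/= (le_trans (ler_norm _)).
- exact/measurable_EFinP.
- by move=> t /gc ->.
Qed.

Let nnID g g' : cube_bounded g -> cube_bounded g' -> (forall t, 0 <= g t) ->
  (forall t, 0 <= g' t) -> nnI (fun t => g t + g' t) = nnI g + nnI g'.
Proof.
move=> Bg Bg' g0 g'0; rewrite /nnI -fineD ?nnI_fin// -leb_nnintD//.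
- by case: Bg => mg _ _; exact/measurable_EFinP.
- by case: Bg' => mg _ _; exact/measurable_EFinP.
Qed.

Let nnIZ k g : 0 <= k -> cube_bounded g -> (forall t, 0 <= g t) ->
  nnI (fun t => k * g t) = k * nnI g.
Proof.
move=> k0 Bg g0; rewrite /nnI -[k in RHS]/(fine k%:E) -fineM ?nnI_fin// -leb_nnintZ//.
by case: Bg => mg _ _; exact/measurable_EFinP.
Qed.

Lemma cube_boundedD g g' : cube_bounded g -> cube_bounded g' ->
  cube_bounded (fun t => g t + g' t).
Proof.
move=> [mg gc [M gM]] [mg' gc' [M' gM']]; split.
- exact: measurable_funD.
- by move=> t ct; rewrite gc// gc'// addr0.
- by exists (M + M') => t; rewrite (le_trans (ler_normD _ _))// lerD.
Qed.

Lemma cube_boundedM g (b : d.-tuple R -> R) : cube_bounded g ->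
  measurable_fun setT b -> (exists M, forall t, cube t -> `|b t| <= M) ->
  cube_bounded (fun t => g t * b t).
Proof.
move=> [mg gc [M gM]] mb [M' bM]; split.
- exact: measurable_funM.
- by move=> t ct; rewrite gc// mul0r.
exists (M * `|M'|) => t; have M0 : 0 <= M by exact: le_trans (gM t).
have [ct|ct] := pselect (cube t); last by rewrite gc// mul0r normr0 mulr_ge0.
by rewrite normrM ler_pM// (le_trans (bM _ ct))// ler_norm.
Qed.

Lemma cube_boundedZ k g : cube_bounded g -> cube_bounded (fun t => k * g t).
Proof.
move=> Bg; under eq_fun do rewrite mulrC.
by apply: cube_boundedM => //; exists `|k|.
Qed.

Let max_bounded g : cube_bounded g -> cube_bounded (fun t => Num.max (g t) 0).
Proof.
move=> [mg gc [M gM]]; split.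
- exact: measurable_maxr.
- by move=> t /gc ->; rewrite maxxx.
- exists M => t; rewrite ger0_norm ?le_max ?lexx ?orbT// ge_max.
  by rewrite (le_trans (ler_norm _) (gM t)) (le_trans _ (gM t)).
Qed.

(** Any splitting into nonnegative functions computes [leb_int], because
    [(a - b)^+ + b = (a - b)^- + a]. Additivity and scaling both rest on this. *)
Let leb_int_sub a b : cube_bounded a -> cube_bounded b ->
  (forall t, 0 <= a t) -> (forall t, 0 <= b t) ->
  leb_int (fun t => a t - b t) = nnI a - nnI b.
Proof.
move=> Ba Bb a0 b0.
have Bab : cube_bounded (fun t => a t - b t).
  under eq_fun do rewrite -[- _]mulN1r.
  by apply: cube_boundedD => //; exact: cube_boundedZ.
have Bba : cube_bounded (fun t => - (a t - b t)).
  by under eq_fun do rewrite -[- _]mulN1r; exact: cube_boundedZ.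
have p0 x : 0 <= Num.max x 0 :> R by rewrite le_max lexx orbT.
rewrite /leb_int -/(nnI (fun t => Num.max (a t - b t) 0)).
rewrite -/(nnI (fun t => Num.max (- (a t - b t)) 0)).
apply/eqP; rewrite subr_eq addrAC eq_sym subr_eq -!nnID//; try exact: max_bounded.
apply/eqP; congr (nnI _); apply/funext => t.
by rewrite /Num.max; case: ltrP => h1; case: ltrP => h2; lra.
Qed.

Let decomp g t : g t = Num.max (g t) 0 - Num.max (- g t) 0.
Proof.
have [h|h] := leP 0 (g t).
  by rewrite (max_idPr _) ?subr0 ?oppr_le0.
by rewrite (max_idPl _) ?sub0r ?opprK// oppr_ge0 ltW.
Qed.

Lemma leb_int_nnI g : cube_bounded g -> (forall t, 0 <= g t) -> leb_int g = nnI g.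
Proof.
move=> Bg g0.
have B0 : cube_bounded (fun=> 0) by split => //; exists 0 => t; rewrite normr0.
have := leb_int_sub Bg B0 g0 (fun=> lexx 0).
under eq_fun do rewrite subr0; move=> ->.
(* Additivity at [0 + 0 = 0] forces [nnI 0 = 0]. *)
have := nnID B0 B0 (fun=> lexx 0) (fun=> lexx 0).
by rewrite addr0 => /eqP; rewrite -subr_eq subrr eq_sym => /eqP ->; rewrite subr0.
Qed.

Lemma leb_int_ge0 g : (forall t, 0 <= g t) -> cube_bounded g -> 0 <= leb_int g.
Proof.
by move=> g0 Bg; rewrite leb_int_nnI// fine_ge0// leb_nnint_ge0.
Qed.

Lemma leb_intD g g' : cube_bounded g -> cube_bounded g' ->
  leb_int (fun t => g t + g' t) = leb_int g + leb_int g'.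
Proof.
have p0 x : 0 <= Num.max x 0 :> R by rewrite le_max lexx orbT.
have BN g1 : cube_bounded g1 -> cube_bounded (fun t => - g1 t).
  by move=> B1; under eq_fun do rewrite -[- _]mulN1r; exact: cube_boundedZ.
move=> Bg Bg'.
have -> : (fun t => g t + g' t) = (fun t => (Num.max (g t) 0 + Num.max (g' t) 0) -
   (Num.max (- g t) 0 + Num.max (- g' t) 0)).
  apply/funext => t; rewrite {1}(decomp g t) {1}(decomp g' t); ring.
rewrite leb_int_sub; [|exact/cube_boundedD/max_bounded/Bg'/max_bounded|
  exact/cube_boundedD/max_bounded/BN/Bg'/max_bounded/BN|
  by move=> t; rewrite addr_ge0|by move=> t; rewrite addr_ge0].
rewrite !nnID//; do ?[exact: max_bounded|exact/max_bounded/BN].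
by rewrite /leb_int /nnI; ring.
Qed.

Lemma leb_intZ k g : cube_bounded g -> leb_int (fun t => k * g t) = k * leb_int g.
Proof.
have p0 x : 0 <= Num.max x 0 :> R by rewrite le_max lexx orbT.
move=> Bg.
have BN : cube_bounded (fun t => - g t).
  by under eq_fun do rewrite -[- _]mulN1r; exact: cube_boundedZ.
have Bp := max_bounded Bg; have Bn := max_bounded BN.
have [k0|k0] := leP 0 k.
  have -> : (fun t => k * g t) = (fun t => k * Num.max (g t) 0 - k * Num.max (- g t) 0).
    by apply/funext => t; rewrite {1}(decomp g t) mulrBr.
  rewrite leb_int_sub; do ?[exact: cube_boundedZ|by move=> t; rewrite mulr_ge0].
  by rewrite !nnIZ// /leb_int /nnI; ring.
have Nk0 : 0 <= - k by lra.
have -> : (fun t => k * g t) = (fun t => - k * Num.max (- g t) 0 - - k * Num.max (g t) 0).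
  by apply/funext => t; rewrite {1}(decomp g t); ring.
rewrite leb_int_sub; do ?[exact: cube_boundedZ|by move=> t; rewrite mulr_ge0].
by rewrite !nnIZ// /leb_int /nnI; ring.
Qed.

Lemma le_leb_int g g' : cube_bounded g -> cube_bounded g' ->
  (forall t, g t <= g' t) -> leb_int g <= leb_int g'.
Proof.
move=> Bg Bg' gg'.
have Bd : cube_bounded (fun t => g' t + -1 * g t).
  by apply: cube_boundedD => //; exact: cube_boundedZ.
have := @leb_int_ge0 (fun t => g' t + -1 * g t) _ Bd.
rewrite leb_intD ?leb_intZ//; last exact: cube_boundedZ.
by rewrite mulN1r subr_ge0; apply => t; rewrite mulN1r subr_ge0.
Qed.

Lemma leb_int_sum (I : Type) (r : seq I) (F : I -> d.-tuple R -> R) :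
  (forall i, cube_bounded (F i)) ->
  cube_bounded (fun t => \sum_(i <- r) F i t) /\
  leb_int (fun t => \sum_(i <- r) F i t) = \sum_(i <- r) leb_int (F i).
Proof.
move=> BF; elim: r => [|i r [IHB IH]].
  have -> : (fun t => \sum_(i <- [::]) F i t) = (fun=> 0).
    by apply/funext => t; rewrite big_nil.
  have B0 : cube_bounded (fun=> 0) by split => //; exists 0 => t; rewrite normr0.
  split=> //; rewrite big_nil.
  by have := leb_intZ 0 B0; under eq_fun do rewrite mulr0; rewrite mul0r.
have -> : (fun t => \sum_(j <- i :: r) F j t) = (fun t => F i t + \sum_(j <- r) F j t).
  by apply/funext => t; rewrite big_cons.
by split; [exact: cube_boundedD|rewrite leb_intD// IH big_cons].
Qed.

End cube_bounded.
End LebInt.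

(** * Bounded measurable functions *)

Section Bounded.
Context {R : realType} {dT : measure_display} {T : measurableType dT}.
Implicit Types f g : T -> R.

Definition bounded_mfun f : Prop :=
  measurable_fun setT f /\ exists M, forall x, `|f x| <= M.

Lemma bounded_mfun_cst k : bounded_mfun (fun=> k).
Proof. by split; [exact: measurable_cst|exists `|k|]. Qed.

Lemma bounded_mfunD f g : bounded_mfun f -> bounded_mfun g ->
  bounded_mfun (fun x => f x + g x).
Proof.
move=> [mf [M fM]] [mg [N gN]]; split; first exact: measurable_funD.
by exists (M + N) => x; rewrite (le_trans (ler_normD _ _))// lerD.
Qed.

Lemma bounded_mfunM f g : bounded_mfun f -> bounded_mfun g ->
  bounded_mfun (fun x => f x * g x).
Proof.
move=> [mf [M fM]] [mg [N gN]]; split; first exact: measurable_funM.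
by exists (M * N) => x; rewrite normrM ler_pM.
Qed.

Lemma bounded_mfun_sum (I : Type) (r : seq I) (F : I -> T -> R) :
  (forall i, bounded_mfun (F i)) -> bounded_mfun (fun x => \sum_(i <- r) F i x).
Proof.
move=> BF; elim: r => [|i r IH].
  by under eq_fun do rewrite big_nil; exact: bounded_mfun_cst.
by under eq_fun do rewrite big_cons; exact: bounded_mfunD.
Qed.

Lemma bounded_mfun_expR f : bounded_mfun f -> bounded_mfun (fun x => expR (f x)).
Proof.
move=> [mf [M fM]]; split; first exact: measurableT_comp.
exists (expR M) => x; rewrite ger0_norm ?expR_ge0// ler_expR.
by rewrite (le_trans (ler_norm _)).
Qed.

Lemma bounded_mfun_comp dT' (T' : measurableType dT') (phi : T' -> T) f :
  measurable_fun setT phi -> bounded_mfun f ->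
  measurable_fun setT (f \o phi) /\ exists M, forall x, `|f (phi x)| <= M.
Proof.
by move=> mphi [mf [M fM]]; split; [exact: measurableT_comp|exists M].
Qed.

End Bounded.

(** * Expectations of bounded random variables *)

Section Expectation.
Context {R : realType} {dO : measure_display} {Omega : measurableType dO}.
Variable P : probability Omega R.
Implicit Types Y Z : Omega -> R.

Lemma bounded_mfun_integrable Y : bounded_mfun Y -> P.-integrable setT (EFin \o Y).
Proof.
move=> [mY [M YM]]; apply: measurable_bounded_integrable => //.
  by rewrite (le_lt_trans (probability_le1 _ _)) ?ltry.
by exists M; split; [exact: num_real|move=> x Mx w _; rewrite /= (le_trans (YM w))// ltW].
Qed.

Lemma ExD Y Z : bounded_mfun Y -> bounded_mfun Z ->
  Ex P (fun w => Y w + Z w) = Ex P Y + Ex P Z.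
Proof. by move=> BY BZ; apply: RintegralD => //; exact: bounded_mfun_integrable. Qed.

Lemma ExZ k Y : bounded_mfun Y -> Ex P (fun w => k * Y w) = k * Ex P Y.
Proof. by move=> BY; apply: RintegralZl => //; exact: bounded_mfun_integrable. Qed.

Lemma Ex_cst k : Ex P (fun=> k) = k.
Proof.
rewrite -[LHS]/(Rintegral P setT (fun=> k)) Rintegral_cst//.
by rewrite (_ : _ setT = 1%E) ?mulr1//; exact: probability_setT.
Qed.

Lemma le_Ex Y Z : bounded_mfun Y -> bounded_mfun Z -> (forall w, Y w <= Z w) ->
  Ex P Y <= Ex P Z.
Proof. by move=> BY BZ YZ; apply: le_Rintegral => //; exact: bounded_mfun_integrable. Qed.

Lemma Ex_sum (I : Type) (r : seq I) (F : I -> Omega -> R) :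
  (forall i, bounded_mfun (F i)) ->
  Ex P (fun w => \sum_(i <- r) F i w) = \sum_(i <- r) Ex P (F i).
Proof.
move=> BF; elim: r => [|i r IH].
  by under eq_fun do rewrite big_nil; rewrite big_nil Ex_cst.
under eq_fun do rewrite big_cons; rewrite ExD// ?IH ?big_cons//.
exact: bounded_mfun_sum.
Qed.

Lemma Ex_le_integral Y k : bounded_mfun Y ->
  (\int[P]_w (Y w)%:E <= k%:E)%E -> Ex P Y <= k.
Proof.
move=> BY; rewrite -lee_fin /Ex fineK//.
exact: integrable_fin_num (bounded_mfun_integrable BY).
Qed.

(* Compare the second-order terms at 0 of the two sides of the moment bound. *)
Lemma subgaussian_variance_le Y (g nu : R) : 0 < g ->
  bounded_mfun Y ->
  (forall lam : R, `|lam| <= g ->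
    (\int[P]_w (expR (lam * Y w))%:E <= (expR (nu ^+ 2 * lam ^+ 2 / 2))%:E)%E) ->
  Ex P (fun w => Y w ^+ 2) <= nu ^+ 2.
Proof.
move=> g0 BY mgf; set v := Ex P _; rewrite leNgt; apply/negP => vnu.
have BY2 : bounded_mfun (fun w => Y w ^+ 2) by exact: bounded_mfunM.
have Be (k : R) : bounded_mfun (fun w => expR (k * Y w)).
  by apply/bounded_mfun_expR/bounded_mfunM => //; exact: bounded_mfun_cst.
have nu0 := sqr_ge0 nu; set N := nu ^+ 2 in vnu nu0 mgf.
(* Averaging the bounds at [lam] and [- lam] cancels the linear term, so [ch_ge_quad] applies. *)
have key (lam : R) : `|lam| <= g -> 1 + lam ^+ 2 / 2 * v <= expR (N * lam ^+ 2 / 2).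
  move=> lg.
  have h1 := Ex_le_integral (Be lam) (mgf _ lg).
  have h2 : Ex P (fun w => expR (- lam * Y w)) <= expR (N * lam ^+ 2 / 2).
    by have := Ex_le_integral (Be (- lam)) (mgf (- lam) _); rewrite normrN sqrrN; apply.
  apply: (@le_trans _ _ (Ex P (fun w => 2^-1 * (expR (lam * Y w) + expR (- lam * Y w))))).
    have -> : 1 + lam ^+ 2 / 2 * v = Ex P (fun w => 1 + lam ^+ 2 / 2 * Y w ^+ 2).
      rewrite ExD ?Ex_cst ?ExZ//; first exact: bounded_mfun_cst.
      by apply: bounded_mfunM => //; exact: bounded_mfun_cst.
    apply: le_Ex.
    - apply: bounded_mfunD; first exact: bounded_mfun_cst.
      by apply: bounded_mfunM => //; exact: bounded_mfun_cst.
    - by apply: bounded_mfunM; [exact: bounded_mfun_cst|exact: bounded_mfunD].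
    - move=> w; have := ch_ge_quad (lam * Y w).
      by rewrite /ch mulNr exprMn; lra.
  rewrite ExZ ?ExD//; last exact: bounded_mfunD.
  lra.
(* The value of [lam^2]: the first entry keeps [lam <= g], and the second makes [l] small enough for
   [v > N] to contradict [key]. *)
pose l := Num.min (g ^+ 2) ((v - N) / (1 + N * v)).
have v0 : 0 < v by lra.
have D0 : 0 < 1 + N * v by rewrite ltr_pwDl// mulr_ge0// ltW.
have l0 : 0 < l by rewrite lt_min exprn_gt0// divr_gt0 ?subr_gt0.
have lg : Num.sqrt l <= g.
  by rewrite -[leRHS](ger0_norm (ltW g0)) -sqrtr_sqr ler_sqrt ?sqr_ge0// ge_min lexx.
have := key (Num.sqrt l); rewrite ger0_norm ?sqrtr_ge0// sqr_sqrtr ?(ltW l0)// => /(_ lg).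
have lD : l * (1 + N * v) <= v - N by rewrite -ler_pdivlMr// ge_min lexx orbT.
have := expR_ge1Dx (- (N * l / 2)); rewrite expRN.
have E0 := expR_gt0 (N * l / 2); move: (expR _) E0 => E E0 h1 h2.
have EE : E * E^-1 = 1 by rewrite divff// gt_eqF.
have h3 : E * (1 - N * l / 2) <= 1 by have := ler_wpM2l (ltW E0) h1; rewrite EE.
have Nl : N * l < 1.
  by rewrite -(ltr_pM2r v0) mul1r; lra.
have : (1 + l / 2 * v) * (1 - N * l / 2) <= 1.
  by apply: le_trans h3; rewrite ler_pM2r//; lra.
have -> : (1 + l / 2 * v) * (1 - N * l / 2) = 1 + l * ((v - N) / 2 - N * v * l / 4) by field.
by rewrite gerDl pmulr_rle0//; lra.
Qed.

End Expectation.

(** * Operator norm and quadratic forms *)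

Section OperatorNorm.
Variable R : realType.

Lemma opnorm_le (p : nat) (M : 'M[R]_p) (v : 'cV[R]_p) :
  enorm (M *m v) <= opnorm M * enorm v.
Proof.
have [->|v0] := eqVneq v 0; first by rewrite mulmx0 enorm0 mulr0.
have ev0 : 0 < enorm v by rewrite enorm_gt0.
(* The Frobenius norm, which bounds the set whose supremum is [opnorm M]. *)
pose C := Num.sqrt (\sum_i enorm (row i M)^T ^+ 2).
have ub u : enorm u <= 1 -> enorm (M *m u) <= C.
  move=> u1; rewrite ler_sqrt; last by apply: sumr_ge0 => i _; exact: sqr_ge0.
  apply: ler_sum => i _.
  have -> : (M *m u) i 0 = dot (row i M)^T u.
    by rewrite mxE; apply: eq_bigr => j _; rewrite !mxE.
  rewrite -real_normK ?num_real// lerXn2r ?nnegrE ?enorm_ge0//.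
  by rewrite (le_trans (dot_abs_le _ _))// ler_piMr ?enorm_ge0.
have : enorm (M *m ((enorm v)^-1 *: v)) <= opnorm M.
  apply: ub_le_sup.
    by exists C => _ [u u1 <-]; exact: ub.
  exists ((enorm v)^-1 *: v) => //=.
  by rewrite enormZ ger0_norm ?invr_ge0 ?enorm_ge0// mulVf ?gt_eqF.
rewrite -scalemxAr enormZ ger0_norm ?invr_ge0 ?enorm_ge0//.
by rewrite mulrC ler_pdivrMr.
Qed.

Lemma qform_le_opnorm (p : nat) (M : 'M[R]_p) (v : 'cV[R]_p) :
  `|qform M v| <= opnorm M * enorm v ^+ 2.
Proof.
rewrite qformE (le_trans (dot_abs_le _ _))// mulrC expr2 mulrA.
by rewrite ler_wpM2r ?enorm_ge0// opnorm_le.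
Qed.

Lemma sym_pd_unitmx (p : nat) (A : 'M[R]_p) : sym_pd A -> A \in unitmx.
Proof.
move=> [_ A0]; rewrite unitmxE unitfE; apply/det0P => -[v v0 vA].
have := A0 v^T; rewrite trmx_eq0 => /(_ v0).
by rewrite /qform trmxK vA mul0mx mxE ltxx.
Qed.

Lemma qform_sqr (p : nat) (A : 'M[R]_p) (v : 'cV[R]_p) : A^T = A ->
  qform (A *m A) v = enorm (A *m v) ^+ 2.
Proof. by move=> sA; rewrite qformE -mulmxA dot_mulmx sA enorm_sqr. Qed.

(** At [D v] the form of [1 - D^-1 A D^-1] equals [|D v|^2 - qform A v]. *)
Lemma qform_whitened_le (p : nat) (D A : 'M[R]_p) (v : 'cV[R]_p) (delta : R) :
  sym_pd D -> opnorm (1%:M - invmx D *m A *m invmx D) <= delta ->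
  qform A v <= (1 + delta) * enorm (D *m v) ^+ 2.
Proof.
move=> Dpd hop; have Du := sym_pd_unitmx Dpd; have [sD _] := Dpd.
have sB : (invmx D)^T = invmx D by rewrite trmx_inv sD.
have /ler_normlP[] := le_trans (qform_le_opnorm _ (D *m v))
  (ler_wpM2r (sqr_ge0 _) hop).
have -> : qform (1%:M - invmx D *m A *m invmx D) (D *m v) =
    enorm (D *m v) ^+ 2 - qform A v.
  rewrite !qformE mulmxBl mul1mx -!mulmxA mulKmx// dotDr -enorm_sqr.
  rewrite [dot _ (- _)]dotC dotNl [dot (invmx D *m _) _]dotC.
  by rewrite (dot_mulmx (invmx D)) sB mulKmx.
by move=> h _; lra.
Qed.

End OperatorNorm.

(** * The local log-likelihood as an exponential family *)

Section Model.
Variable R : realType.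
Variables (d p : nat) (K : d.-tuple R -> R) (psi : 'I_p -> d.-tuple R -> R).
Hypothesis mK : measurable_fun setT K.
Hypothesis K0 : forall t, 0 <= K t.
Hypothesis bK : exists M : R, forall t, K t <= M.
Hypothesis cK : forall t, ~ cube t -> K t = 0.
Hypothesis mpsi : forall j, measurable_fun setT (psi j).
Hypothesis bpsi : forall j, exists M : R, forall t, `|psi j t| <= M.
Implicit Types (th v : 'cV[R]_p) (b : d.-tuple R -> R).

Lemma bounded_kernel : bounded_mfun K.
Proof. by split=> //; have [M KM] := bK; exists M => t; rewrite ger0_norm. Qed.

Lemma bounded_psi j : bounded_mfun (psi j).
Proof. by []. Qed.

Lemma bounded_psi_dot th : bounded_mfun (fun t => psi_dot psi t th).
Proof.
apply: bounded_mfun_sum => j; apply: bounded_mfunM; first exact: bounded_psi.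
exact: bounded_mfun_cst.
Qed.

Lemma psi_dotD t th v : psi_dot psi t (th + v) = psi_dot psi t th + psi_dot psi t v.
Proof. by rewrite -big_split; apply: eq_bigr => j _; rewrite mxE mulrDr. Qed.

Lemma psi_dotZ t k v : psi_dot psi t (k *: v) = k * psi_dot psi t v.
Proof. by rewrite /psi_dot mulr_sumr; apply: eq_bigr => j _; rewrite mxE mulrCA. Qed.

Lemma psi_dotN t v : psi_dot psi t (- v) = - psi_dot psi t v.
Proof. by rewrite -scaleN1r psi_dotZ mulN1r. Qed.

Lemma cube_bounded_kernelM b : bounded_mfun b -> cube_bounded (fun t => K t * b t).
Proof.
move=> [mb [M bM]]; apply: cube_boundedM => //; last by exists M.
by split=> //; have [N KN] := bK; exists N => t; rewrite ger0_norm.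
Qed.

(** A positive linear functional of [b] giving the normalising integral, its gradient and its
    Hessian at [b = 1], [psi j] and [psi j * psi k]. By [ktilt_shift], a change of parameter becomes
    a change of [b], and integral inequalities become pointwise ones. *)
Definition ktilt th b := leb_int (fun t => K t * (expR (psi_dot psi t th) * b t)).

Lemma cube_bounded_ktilt th b : bounded_mfun b ->
  cube_bounded (fun t => K t * (expR (psi_dot psi t th) * b t)).
Proof.
move=> Bb; apply/cube_bounded_kernelM/bounded_mfunM => //.
exact/bounded_mfun_expR/bounded_psi_dot.
Qed.

Lemma ktiltD th b b' : bounded_mfun b -> bounded_mfun b' ->
  ktilt th (fun t => b t + b' t) = ktilt th b + ktilt th b'.
Proof.
move=> Bb Bb'; rewrite /ktilt -leb_intD; do ?exact: cube_bounded_ktilt.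
by congr leb_int; apply/funext => t; ring.
Qed.

Lemma ktiltZ th k b : bounded_mfun b -> ktilt th (fun t => k * b t) = k * ktilt th b.
Proof.
move=> Bb; rewrite /ktilt -leb_intZ; last exact: cube_bounded_ktilt.
by congr leb_int; apply/funext => t; ring.
Qed.

Lemma le_ktilt th b b' : bounded_mfun b -> bounded_mfun b' -> (forall t, b t <= b' t) ->
  ktilt th b <= ktilt th b'.
Proof.
move=> Bb Bb' bb'; apply: le_leb_int; do ?exact: cube_bounded_ktilt.
by move=> t; rewrite ler_wpM2l// ler_wpM2l ?expR_ge0.
Qed.

Lemma ktilt_sum th (I : Type) (r : seq I) (F : I -> d.-tuple R -> R) :
  (forall i, bounded_mfun (F i)) ->
  ktilt th (fun t => \sum_(i <- r) F i t) = \sum_(i <- r) ktilt th (F i).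
Proof.
move=> BF; rewrite /ktilt -(leb_int_sum _ (fun i => cube_bounded_ktilt th (BF i))).2.
by congr leb_int; apply/funext => t; rewrite !mulr_sumr.
Qed.

Lemma ktilt_shift th v b :
  ktilt (th + v) b = ktilt th (fun t => expR (psi_dot psi t v) * b t).
Proof. by congr leb_int; apply/funext => t; rewrite psi_dotD expRD; ring. Qed.

Let bounded_one : bounded_mfun (fun=> 1 : R) := @bounded_mfun_cst R _ (d.-tuple R) 1.

Variables (n : nat) (x0 : d.-tuple R) (h : R).
Let N := n%:R * h ^+ d.
Hypothesis h0 : 0 < h.

Let N0 : 0 <= N.
Proof. by rewrite mulr_ge0// exprn_ge0// ltW. Qed.

(** The sufficient statistic: the data enter [L] only through this vector. *)
Definition stat (x : 'I_n -> d.-tuple R) : 'cV[R]_p :=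
  \col_j \sum_i K (rescale x0 h (x i)) * psi j (rescale x0 h (x i)).

Lemma loglikE x th : loglik K psi x0 h x th = dot (stat x) th - N * ktilt th (fun=> 1).
Proof.
rewrite /loglik; congr (_ - N * _).
  rewrite /dot /psi_dot; under eq_bigr do rewrite mulr_sumr.
  rewrite exchange_big/=; apply: eq_bigr => j _; rewrite mxE mulr_suml.
  by apply: eq_bigr => i _; rewrite mulrA.
by congr leb_int; apply/funext => t; rewrite mulr1.
Qed.

Lemma loglik_gradE x th j :
  loglik_grad K psi x0 h x th j 0 = stat x j 0 - N * ktilt th (psi j).
Proof.
rewrite !mxE; congr (_ - N * _).
by congr leb_int; apply/funext => t; ring.
Qed.

Lemma dot_loglik_grad x th v : dot (loglik_grad K psi x0 h x th) v =
  dot (stat x) v - N * ktilt th (fun t => psi_dot psi t v).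
Proof.
rewrite /psi_dot ktilt_sum; last first.
  by move=> j; apply: bounded_mfunM; [exact: bounded_psi|exact: bounded_mfun_cst].
rewrite mulr_sumr -sumrB; apply: eq_bigr => j _; rewrite loglik_gradE mulrBl.
congr (_ - _); rewrite -mulrA; congr (_ * _).
under [in RHS]eq_fun do rewrite mulrC.
by rewrite ktiltZ 1?mulrC//; exact: bounded_psi.
Qed.

Lemma qform_Dn2 th v :
  qform (Dn2 n K psi h th) v = N * ktilt th (fun t => psi_dot psi t v ^+ 2).
Proof.
have Bp j : bounded_mfun (fun t => psi j t * v j 0).
  by apply: bounded_mfunM; [exact: bounded_psi|exact: bounded_mfun_cst].
have -> : (fun t => psi_dot psi t v ^+ 2) =
    (fun t => \sum_j \sum_k (psi j t * v j 0) * (psi k t * v k 0)).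
  by apply/funext => t; rewrite expr2 /psi_dot mulr_suml; apply: eq_bigr => j _; rewrite mulr_sumr.
rewrite ktilt_sum; last by move=> j; apply: bounded_mfun_sum => k; exact: bounded_mfunM.
rewrite qformE /dot mulr_sumr; apply: eq_bigr => j _.
rewrite ktilt_sum; last by move=> k; exact: bounded_mfunM.
rewrite mxE !mulr_sumr; apply: eq_bigr => k _; rewrite mxE.
have -> : (fun t => psi j t * v j 0 * (psi k t * v k 0)) =
    (fun t => (v j 0 * v k 0) * (psi j t * psi k t)).
  by apply/funext => t; ring.
rewrite ktiltZ; last by apply: bounded_mfunM; exact: bounded_psi.
have -> : leb_int (fun t => K t * psi j t * psi k t * expR (psi_dot psi t th)) =
    ktilt th (fun t => psi j t * psi k t).
  by congr leb_int; apply/funext => t; ring.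
rewrite -/N; ring.
Qed.

(** Convexity of the normalising integral along a segment, that is, concavity of [L]. *)
Let shift_le th v k : 0 <= k <= 1 ->
  ktilt (th + k *: v) (fun=> 1) - ktilt th (fun=> 1) <=
  k * (ktilt (th + v) (fun=> 1) - ktilt th (fun=> 1)).
Proof.
move=> /andP[k0 k1]; rewrite !ktilt_shift.
have Be u : bounded_mfun (fun t => expR (psi_dot psi t u) * 1).
  by apply: bounded_mfunM => //; exact/bounded_mfun_expR/bounded_psi_dot.
set A := ktilt th (fun t => expR (psi_dot psi t (k *: v)) * 1).
set B := ktilt th (fun t => expR _ * 1); set C := ktilt th (fun=> 1).
suff : A <= k * B + (1 - k) * C by lra.
rewrite -!ktiltZ// -ktiltD; last 2 first.
- by apply: bounded_mfunM => //; exact: bounded_mfun_cst.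
- by apply: bounded_mfunM => //; exact: bounded_mfun_cst.
apply: le_ktilt => //.
  by apply: bounded_mfunD; apply: bounded_mfunM => //; exact: bounded_mfun_cst.
move=> t; rewrite psi_dotZ !mulr1; set a := psi_dot psi t v.
(* The tangent to exp at [k a] lies below exp at 0 and at [a]; weights [1 - k] and [k] give
   [e^(ka) <= k e^a + 1 - k]. *)
have := expR_ge1Dx (a - k * a); have := expR_ge1Dx (- (k * a)).
rewrite expRN expRD expRN; have := expR_gt0 (k * a); have := expR_gt0 a.
move: (expR (k * a)) (expR a) => E F F0 E0 h1 h2.
have EE : E * E^-1 = 1 by rewrite divff// gt_eqF.
have h3 : E * (1 - k * a) <= 1 by have := ler_wpM2l (ltW E0) h1; rewrite EE.
have h4 : E * (1 + (a - k * a)) <= F.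
  by have := ler_wpM2l (ltW E0) h2; rewrite mulrCA EE mulr1.
have k10 : 0 <= 1 - k by lra.
have := ler_wpM2l k10 h3; have := ler_wpM2l k0 h4; lra.
Qed.

(** Cutting the ray at radius [r] places [th - v] in the region where the Hessian is controlled by
    hypothesis. *)
Lemma deviation_grad_ge (x : 'I_n -> d.-tuple R) th u (D : 'M[R]_p) (r delta : R) :
  sym_pd D -> D *m D = Dn2 n K psi h th ->
  (forall th', enorm (D *m (th' - th)) <= r ->
    opnorm (1%:M - invmx D *m Dn2 n K psi h th' *m invmx D) <= delta) ->
  0 < r -> delta <= 1 / 2 -> r < enorm (D *m u) ->
  loglik K psi x0 h x th <= loglik K psi x0 h x (th + u) ->
  exists2 v, enorm (D *m v) = r & 5 / 12 * r ^+ 2 <= dot (loglik_grad K psi x0 h x th) v.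
Proof.
move=> Dpd DD L0 r0 delta2 ru Lu; have [sD _] := Dpd.
have u0 : 0 < enorm (D *m u) by exact: lt_trans ru.
pose k := r / enorm (D *m u); pose v := k *: u.
have k0 : 0 < k by rewrite divr_gt0.
have k1 : k <= 1 by rewrite ler_pdivrMr// mul1r ltW.
have vr : enorm (D *m v) = r by rewrite -scalemxAr enormZ gtr0_norm// divfK ?gt_eqF.
exists v => //.
have Bp v' := bounded_psi_dot v'.
have Be v' := bounded_mfun_expR (Bp v').
have Bc := @bounded_mfun_cst R _ (d.-tuple R : measurableType _).
have Bm := @bounded_mfunM R _ (d.-tuple R : measurableType _).
have Bd := @bounded_mfunD R _ (d.-tuple R : measurableType _).
(* By concavity [L(th + v) - L(th) >= k (L(th + u) - L(th)) >= 0]. *)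
have low : N * (ktilt (th + v) (fun=> 1) - ktilt th (fun=> 1)) <= dot (stat x) v.
  have kk : 0 <= k <= 1 by rewrite ltW.
  apply: (le_trans (ler_wpM2l N0 (shift_le th u kk))).
  rewrite dotZr mulrCA ler_wpM2l ?(ltW k0)//.
  by move: Lu; rewrite !loglikE dotDr; lra.
(* [expR_taylor2_ge] integrated against the tilt at [th]; the factor [e^(-t)] shifts the tilt to
   [th - v]. *)
have tay : 2 / 3 * ktilt th (fun t => psi_dot psi t v ^+ 2) -
    6^-1 * ktilt (th - v) (fun t => psi_dot psi t v ^+ 2) <=
    ktilt (th + v) (fun=> 1) - ktilt th (fun=> 1) - ktilt th (fun t => psi_dot psi t v).
  rewrite !ktilt_shift.
  have B2 : bounded_mfun (fun t => psi_dot psi t v ^+ 2) by exact: (Bm _ _ (Bp v) (Bp v)).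
  have B3 : bounded_mfun (fun t => expR (psi_dot psi t (- v)) * psi_dot psi t v ^+ 2).
    exact: (Bm _ _ (Be _) B2).
  have B4 : bounded_mfun (fun t => expR (psi_dot psi t v) * 1) by exact: (Bm _ _ (Be _) (Bc 1)).
  have h1 : ktilt th (fun t => 2 / 3 * psi_dot psi t v ^+ 2 +
      - 6^-1 * (expR (psi_dot psi t (- v)) * psi_dot psi t v ^+ 2)) <=
      ktilt th (fun t => expR (psi_dot psi t v) * 1 + (-1 * 1 + -1 * psi_dot psi t v)).
    apply: le_ktilt.
    - by apply: (Bd); apply: (Bm).
    - by apply: (Bd) => //; apply: (Bd); apply: (Bm).
    - move=> t; rewrite psi_dotN; have := expR_taylor2_ge (psi_dot psi t v); lra.
  move: h1; rewrite !ktiltD//; do ?[by apply: (Bd); apply: (Bm)|by apply: (Bm)].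
  by rewrite !ktiltZ//; lra.
have q1 := qform_Dn2 th v; have q2 := qform_Dn2 (th - v) v.
have q3 : qform (Dn2 n K psi h th) v = r ^+ 2 by rewrite -DD qform_sqr// vr.
have q4 : qform (Dn2 n K psi h (th - v)) v <= (1 + delta) * r ^+ 2.
  rewrite -vr; apply: qform_whitened_le => //; apply: L0.
  by rewrite addrAC subrr add0r mulmxN -scaleN1r enormZ normrN1 mul1r vr.
(* The constant is [2/3 - (1 + 1/2)/6 = 5/12]. *)
rewrite dot_loglik_grad; have := ler_wpM2l N0 tay; have := sqr_ge0 r; nra.
Qed.

(** * First-order condition at the target *)

Section score.
Context {dO : measure_display} {Omega : measurableType dO}.
Variable P : probability Omega R.
Variable X : 'I_n -> Omega -> d.-tuple R.
Hypothesis mX : forall i, measurable_fun setT (X i).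

Lemma bounded_stat j : bounded_mfun (fun w => stat (fun i => X i w) j 0).
Proof.
under eq_fun do rewrite mxE.
apply: bounded_mfun_sum => i.
have mr : measurable_fun setT (fun w => rescale x0 h (X i w)).
  apply/measurable_fun_tnthP => k /=.
  rewrite (_ : _ \o _ = fun w => (tnth (X i w) k - tnth x0 k) / h); last first.
    by apply/funext => w /=; rewrite tnth_mktuple.
  apply: measurable_funM => //; apply: measurable_funB => //.
  exact: (measurableT_comp (measurable_tnth k) (mX i)).
exact: (bounded_mfun_comp mr (bounded_mfunM bounded_kernel (bounded_psi j))).
Qed.

Lemma bounded_loglik_grad th j :
  bounded_mfun (fun w => loglik_grad K psi x0 h (fun i => X i w) th j 0).
Proof.
under eq_fun do rewrite loglik_gradE.
apply: bounded_mfunD; [exact: bounded_stat|exact: bounded_mfun_cst].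
Qed.

(** Instead of differentiating under the integral, compare [th] with [th + s e_j]. A quadratic bound
    on exp gives [s c <= s^2 C] for small [s] of either sign, which forces [c = 0]. *)
Lemma Ex_loglik_grad_eq0 th :
  (forall th', Ex P (fun w => loglik K psi x0 h (fun i => X i w) th') <=
               Ex P (fun w => loglik K psi x0 h (fun i => X i w) th)) ->
  forall j, Ex P (fun w => loglik_grad K psi x0 h (fun i => X i w) th j 0) = 0.
Proof.
move=> thmax j.
pose m j := Ex P (fun w => stat (fun i => X i w) j 0).
have ExL th' : Ex P (fun w => loglik K psi x0 h (fun i => X i w) th') =
    \sum_j m j * th' j 0 - N * ktilt th' (fun=> 1).
  have Bs k : bounded_mfun (fun w => stat (fun i => X i w) k 0 * th' k 0).
    by apply: bounded_mfunM; [exact: bounded_stat|exact: bounded_mfun_cst].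
  under [in LHS]eq_fun do rewrite loglikE.
  rewrite ExD; [|exact: bounded_mfun_sum|exact: bounded_mfun_cst].
  rewrite Ex_cst; congr (_ - _); rewrite Ex_sum//; apply: eq_bigr => k _.
  under eq_fun do rewrite mulrC.
  by rewrite ExZ 1?mulrC//; exact: bounded_stat.
have -> : Ex P (fun w => loglik_grad K psi x0 h (fun i => X i w) th j 0) =
    m j - N * ktilt th (psi j).
  under eq_fun do rewrite loglik_gradE.
  by rewrite ExD ?Ex_cst//; [exact: bounded_stat|exact: bounded_mfun_cst].
set c := m j - _.
have [M0 psiM] := bpsi j.
pose M := `|M0| + 1; have M1 : 0 < M by rewrite ltr_wpDl.
have {}psiM t : `|psi j t| <= M by rewrite (le_trans (psiM t))// (le_trans (ler_norm _))// lerDl.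
pose C := N * (2 * M ^+ 2 * ktilt th (fun=> 1)).
have I0 : 0 <= ktilt th (fun=> 1).
  apply: leb_int_ge0; last exact: cube_bounded_ktilt.
  by move=> t; rewrite mulr_ge0// mulr1 expR_ge0.
have C0 : 0 <= C by rewrite !mulr_ge0// ltW// exprn_gt0.
have Bpj := bounded_psi j.
(* The restriction gives [|s psi_j| <= 1/2], where [e^y <= 1 + y + 2 y^2]. *)
have step (s : R) : `|s| * M <= 1 / 2 -> s * c <= s ^+ 2 * C.
  move=> sM; pose e : 'cV[R]_p := delta_mx j 0.
  have pe t : psi_dot psi t e = psi j t.
    rewrite /psi_dot (bigD1 j)//= mxE !eqxx mulr1 big1 ?addr0// => k kj.
    by rewrite mxE (negbTE kj) mulr0.
  have me : \sum_k m k * (th + s *: e) k 0 = \sum_k m k * th k 0 + s * m j.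
    under eq_bigr do rewrite !mxE mulrDr.
    rewrite big_split/=; congr (_ + _).
    rewrite (bigD1 j)//= !eqxx mulr1 mulrC big1 ?addr0// => k kj.
    by rewrite (negbTE kj)/= mulr0 mulr0.
  have := thmax (th + s *: e); rewrite !ExL me ktilt_shift => le1.
  have le2 : ktilt th (fun t => expR (psi_dot psi t (s *: e)) * 1) <=
      ktilt th (fun t => (1 + s * psi j t) + s ^+ 2 * (2 * M ^+ 2) * 1).
    have Bs : bounded_mfun (fun t => s * psi j t).
      by apply: bounded_mfunM => //; exact: bounded_mfun_cst.
    apply: le_ktilt.
    - by apply: bounded_mfunM => //; exact/bounded_mfun_expR/bounded_psi_dot.
    - by apply: bounded_mfunD; [exact: bounded_mfunD|apply: bounded_mfunM => //; exact: bounded_mfun_cst].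
    - move=> t; rewrite psi_dotZ pe !mulr1; set y := s * psi j t.
      have yM : `|y| <= `|s| * M by rewrite normrM ler_wpM2l.
      have y2 : y ^+ 2 <= s ^+ 2 * M ^+ 2.
        rewrite -[y ^+ 2]real_normK ?num_real// -[s ^+ 2]real_normK ?num_real//.
        by rewrite -exprMn lerXn2r ?nnegrE ?mulr_ge0// ltW.
      have /ler_normlP[y3 y4] := le_trans yM sM.
      have := expR_ge1Dx (- y); rewrite expRN; have := expR_gt0 y.
      move: (expR y) => E E0 h1.
      have h3 : E * (1 - y) <= 1 by have := ler_wpM2l (ltW E0) h1; rewrite divff ?gt_eqF//.
      have y1 : 0 < 1 - y by lra.
      have h4 : E <= 1 + y + 2 * y ^+ 2.
        have h5 : 1 <= (1 + y + 2 * y ^+ 2) * (1 - y).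
          have -> : (1 + y + 2 * y ^+ 2) * (1 - y) = 1 + y ^+ 2 * (1 - 2 * y) by ring.
          by rewrite lerDl mulr_ge0 ?sqr_ge0//; lra.
        by rewrite -(ler_pM2r y1) (le_trans h3).
      lra.
  have Bs : bounded_mfun (fun t => s * psi j t).
    by apply: bounded_mfunM => //; exact: bounded_mfun_cst.
  move: le2; rewrite !ktiltD//; do ?[by apply: bounded_mfunD|by apply: bounded_mfunM => //; exact: bounded_mfun_cst].
  rewrite !ktiltZ// => le2; have := ler_wpM2l N0 le2.
  rewrite /c /C; lra.
apply/eqP/negPn/negP => c0.
(* The first entry satisfies the restriction in [step]; the second makes [s^2 C] smaller than
   [s c = |s| |c|]. *)
pose s := Num.sg c * Num.min (1 / (2 * M)) (`|c| / (2 * (C + 1))).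
have nc : 0 < `|c| by rewrite normr_gt0.
set mm := Num.min _ _ in s; have mm0 : 0 < mm.
  by rewrite lt_min !divr_gt0 ?mulr_gt0//; lra.
have ns : `|s| = mm by rewrite normrM normr_sg c0 mul1r gtr0_norm.
have sc : s * c = mm * `|c| by rewrite /s mulrAC -normrEsg mulrC.
have := step s; rewrite ns => step'.
have : mm * M <= 1 / 2.
  have : mm <= 1 / (2 * M) by rewrite ge_min lexx.
  by move=> /(ler_wpM2r (ltW M1)); rewrite (_ : 1 / (2 * M) * M = 1 / 2)//; field; rewrite gt_eqF.
move=> /step'; rewrite -[s ^+ 2]real_normK ?num_real// ns sc expr2 -mulrA ler_pM2l//.
have : mm * (2 * (C + 1)) <= `|c|.
  by rewrite -ler_pdivlMr ?ge_min ?lexx ?orbT// mulr_gt0//; lra.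
nra.
Qed.

End score.
End Model.

(** * Concentration of the estimator *)

Theorem theorem1 (R : realType) (dO : measure_display) (Omega : measurableType dO)
  (P : probability Omega R)
  (d p n : nat) (h : R) (x0 : d.-tuple R)
  (X : 'I_n -> Omega -> d.-tuple R) (f : d.-tuple R -> R)
  (K : d.-tuple R -> R) (psi : 'I_p -> d.-tuple R -> R)
  (theta_tilde : Omega -> 'cV[R]_p) (theta_star : 'cV[R]_p)
  (Dn Vn : 'M[R]_p)
  (a nu0 g z delta : R) :
  (* setting *)
  (0 < d)%N -> (0 < p)%N -> (0 < n)%N -> 0 < h ->
  (forall i, measurable_fun setT (X i)) ->
  mutually_independent P X ->
  (forall t, 0 <= f t) -> measurable_fun setT f ->
  (forall i (A : set (d.-tuple R)), measurable A ->
     P (X i @^-1` A) = leb_nnint (fun t => (f t * \1_A t)%:E)) ->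
  measurable_fun setT K -> (forall t, 0 <= K t) ->
  (exists M : R, forall t, K t <= M) ->
  (forall t, ~ cube t -> K t = 0) ->
  (forall j, measurable_fun setT (psi j)) ->
  (forall j, exists M : R, forall t, `|psi j t| <= M) ->
  (forall j t, ~ cube t -> psi j t = 0) ->
  (forall j : 'I_p, nat_of_ord j = 0%N -> forall t, cube t -> psi j t = 1) ->
  (forall c : 'I_p -> R,
     (forall t, 0 < K t -> \sum_j c j * psi j t = 0) -> forall j, c j = 0) ->
  (* the MLE and the target *)
  (forall j : 'I_p, measurable_fun setT (fun w => theta_tilde w j 0)) ->
  (forall w th, loglik K psi x0 h (fun i => X i w) th
                <= loglik K psi x0 h (fun i => X i w) (theta_tilde w)) ->
  (forall th, Ex P (fun w => loglik K psi x0 h (fun i => X i w) th)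
              <= Ex P (fun w => loglik K psi x0 h (fun i => X i w) theta_star)) ->
  (* D_n and V_n *)
  sym_pd Dn -> Dn *m Dn = Dn2 n K psi h theta_star ->
  sym_pd Vn ->
  Vn *m Vn = covmx P (fun w => loglik_grad K psi x0 h (fun i => X i w) theta_star) ->
  (* constants *)
  0 < a -> 0 < nu0 -> 0 < g -> 0 < z -> z <= g ^+ 2 / 4 -> 0 <= delta ->
  let r0 := 4 * a * nu0 * (Num.sqrt p%:R + Num.sqrt (2 * z)) in
  let zeta := a * nu0 * (Num.sqrt p%:R + Num.sqrt (2 * z)) in
  let Theta := [set th : 'cV[R]_p | enorm (Dn *m (th - theta_star)) <= r0] in
  (* (I) *)
  loewner_ge (a ^+ 2 *: Dn2 n K psi h theta_star) (Vn *m Vn) ->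
  (* (ED0) *)
  (let Y := fun w => invmx Vn *m loglik_grad K psi x0 h (fun i => X i w) theta_star in
   let zeta_v := fun w => Y w - Exv P Y in
   forall gam : 'cV[R]_p, gam != 0 -> forall lam : R, `|lam| <= g ->
     (\int[P]_w (expR (lam * (gam^T *m zeta_v w) 0 0 / enorm gam))%:E
       <= (expR (nu0 ^+ 2 * lam ^+ 2 / 2))%:E)%E) ->
  (* (L0) *)
  (forall th, Theta th ->
     opnorm (1%:M - invmx Dn *m Dn2 n K psi h th *m invmx Dn) <= delta) ->
  (* (C) *)
  r0 * (1 - delta) >= 2 * zeta ->
  (P [set w | ~ Theta (theta_tilde w)]
     <= (2 * expR (- z) + (84 / 10) * expR (- (g ^+ 2 / 4)))%:E)%E.
Proof.
move=> d0 p0 n0 h0 mX _ _ _ _ mK K0 bK cK mpsi bpsi _ _ _ mth Lmax ELmax.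
move=> Dpd DD Vpd VV a0 nu00 g0 z0 zg delta0 r0 zeta Theta condI ED0 L0 condC.
have [sD _] := Dpd; have [sV _] := Vpd.
have Vu := sym_pd_unitmx Vpd.
pose G w := loglik_grad K psi x0 h (fun i => X i w) theta_star.
pose Y w := invmx Vn *m G w.
have BG j : bounded_mfun (fun w => G w j 0) by exact: bounded_loglik_grad.
have EG0 j : Ex P (fun w => G w j 0) = 0 by exact: Ex_loglik_grad_eq0.
have Bc := @bounded_mfun_cst R _ Omega.
have Bdot u : bounded_mfun (fun w => dot u (G w)).
  by apply: bounded_mfun_sum => j; apply: bounded_mfunM.
have YE w j : Y w j 0 = dot (row j (invmx Vn))^T (G w).
  by rewrite mxE; apply: eq_bigr => k _; rewrite !mxE.
have BY j : bounded_mfun (fun w => Y w j 0).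
  by under eq_fun do rewrite YE; exact: Bdot.
have EY : Exv P Y = 0.
  apply/colP => j; rewrite !mxE; under eq_fun do rewrite YE.
  rewrite Ex_sum => [|k]; last exact: bounded_mfunM.
  by rewrite big1// => k _; rewrite ExZ// EG0 mulr0.
have dotY u w : dot u (Y w) = dot (invmx Vn *m u) (G w).
  by rewrite dot_mulmx trmx_inv sV.
(* The whitened score [Y] has identity covariance: substitute [b = Vn^-1 u] in the form of
   [Vn^2]. *)
have varY u : Ex P (fun w => dot u (Y w) ^+ 2) = enorm u ^+ 2.
  have -> : enorm u ^+ 2 = qform (Vn *m Vn) (invmx Vn *m u).
    by rewrite qform_sqr// mulKVmx.
  set b := invmx Vn *m u.
  have -> : (fun w => dot u (Y w) ^+ 2) =
      (fun w => \sum_j \sum_k (b j 0 * b k 0) * (G w j 0 * G w k 0)).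
    apply/funext => w; rewrite dotY -/b expr2 /dot mulr_suml; apply: eq_bigr => j _.
    by rewrite mulr_sumr; apply: eq_bigr => k _; ring.
  have Bjk j k : bounded_mfun (fun w => b j 0 * b k 0 * (G w j 0 * G w k 0)).
    by apply: bounded_mfunM => //; exact: bounded_mfunM.
  rewrite Ex_sum => [|j]; last exact: bounded_mfun_sum.
  rewrite VV qformE; apply: eq_bigr => j _.
  rewrite Ex_sum// [X in _ = _ * X]mxE mulr_sumr; apply: eq_bigr => k _.
  rewrite ExZ; last exact: bounded_mfunM.
  rewrite [covmx _ _ _ _]mxE ![Exv _ _ _ _]mxE !EG0; under [in RHS]eq_fun do rewrite !subr0.
  by rewrite -/G; ring.
have mgfY u (lam : R) : u != 0 -> `|lam| <= g ->
    (\int[P]_w (expR (lam * dot u (Y w) / enorm u))%:E <=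
     (expR (nu0 ^+ 2 * lam ^+ 2 / 2))%:E)%E.
  move=> u0 lg; have := ED0 u u0 lam lg.
  by under eq_integral do rewrite -/(Y _) EY subr0 dotE.
(* A unit direction of [Y] has variance 1, which (ED0) bounds by [nu0^2]. *)
have nu1 : 1 <= nu0.
  pose e : 'cV[R]_p := delta_mx (Ordinal p0) 0.
  have e2 : enorm e ^+ 2 = 1.
    rewrite enorm_sqr /dot (bigD1 (Ordinal p0))//= big1 => [|k /negbTE k0].
      by rewrite mxE !eqxx mulr1 addr0.
    by rewrite mxE k0 mul0r.
  have e1 : enorm e = 1.
    by apply/eqP; rewrite -(@eqrXn2 _ 2) ?enorm_ge0// e2 expr1n.
  have e0 : e != 0 by rewrite -enorm_eq0 e1 oner_eq0.
  have : Ex P (fun w => dot e (Y w) ^+ 2) <= nu0 ^+ 2.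
    apply: (@subgaussian_variance_le _ _ _ _ _ g) => //.
      by under eq_fun do rewrite dotY; exact: Bdot.
    move=> lam lg; have := mgfY e lam e0 lg.
    by under eq_integral do rewrite e1 divr1.
  by rewrite varY e2 => n2; nra.
pose S := Num.sqrt p%:R + Num.sqrt (2 * z) : R.
have S0 : 0 < S by rewrite ltr_wpDl ?sqrtr_ge0// sqrtr_gt0 mulr_gt0.
have r0E : r0 = 4 * a * nu0 * S by [].
have r00 : 0 < r0 by rewrite r0E !mulr_gt0.
have ar0 : 0 < a * r0 by rewrite mulr_gt0.
(* As [r0 = 4 zeta], condition (C) reads [4 (1 - delta) >= 2]. *)
have delta2 : delta <= 1 / 2.
  have zeta0 : 0 < zeta by rewrite !mulr_gt0.
  have : 0 <= zeta * (4 * (1 - delta) - 2) by move: condC; rewrite r0E /zeta -/S; lra.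
  by rewrite pmulr_rge0//; lra.
pose Z w := nu0^-1 *: Y w.
pose A := [set w | ~ Theta (theta_tilde w)].
have mA : measurable A.
  have mD : measurable_fun setT (fun w => enorm (Dn *m (theta_tilde w - theta_star))).
    apply: (measurableT_comp (continuous_measurable_fun (@sqrt_continuous R))).
    apply: measurable_sum => j; apply: measurable_funX.
    under eq_fun do rewrite mxE.
    apply: measurable_sum => k; apply: measurable_funM => //.
    under eq_fun do rewrite !mxE.
    exact: measurable_funB.
  have -> : A = (fun w => enorm (Dn *m (theta_tilde w - theta_star))) @^-1` `]r0, +oo[%classic.
    apply/seteqP; split => w; rewrite /A /Theta /= in_itv/= andbT; first by move=> /negP; rewrite -ltNge.
    by rewrite ltNge => /negP.
  by rewrite -[X in measurable X]setTI; exact: mD.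
(* The tail bound at [y = sqrt (2 z)] yields [2 e^(-z)]; the other term is nonnegative. *)
apply: (@le_trans _ _ (2 * expR (- (Num.sqrt (2 * z) ^+ 2 / 2)))%:E); last first.
  rewrite lee_fin sqr_sqrtr; last by rewrite mulr_ge0// ltW.
  have -> : 2 * z / 2 = z by field.
  by rewrite lerDl mulr_ge0// expR_ge0.
apply: (@subgaussian_norm_tail _ _ _ P p Z) => //.
- by rewrite sqrtr_gt0 mulr_gt0.
- move=> j; under eq_fun do rewrite mxE.
  by apply: measurable_funM => //; case: (BY j).
- move=> u ug; have [->|u0] := eqVneq u 0.
    under eq_integral do rewrite dot0l expR0.
    rewrite integral_cst// mul1e (_ : _ setT = 1%E); last exact: probability_setT.
    by rewrite enorm0 expr0n/= mul0r expR0.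
  have eu : 0 < enorm u by rewrite enorm_gt0.
  (* (ED0) is taken at [lam = |u| / nu0], admissible since [|u| <= 2 sqrt z <= g] and [nu0 >= 1]. *)
  have lg : `|enorm u / nu0| <= g.
    rewrite ger0_norm ?divr_ge0 ?(ltW eu) ?(ltW nu00)// ler_pdivrMr//.
    rewrite (@le_trans _ _ g)//; last by rewrite ler_peMr// ltW.
    apply: (le_trans ug); rewrite -sqrtrM// -[leRHS](ger0_norm (ltW g0)) -sqrtr_sqr.
    by rewrite ler_sqrt ?sqr_ge0//; lra.
  have := mgfY u _ u0 lg.
  have -> : nu0 ^+ 2 * (enorm u / nu0) ^+ 2 / 2 = enorm u ^+ 2 / 2 by field; rewrite gt_eqF.
  move=> /(le_trans _); apply; rewrite le_eqVlt; apply/orP; left; apply/eqP.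
  apply: eq_integral => w _; rewrite dotZr; congr (expR _)%:E.
  by field; rewrite !gt_eqF.
- move=> w Aw.
  have ru : r0 < enorm (Dn *m (theta_tilde w - theta_star)) by rewrite ltNge; apply/negP.
  have Lw : loglik K psi x0 h (fun i => X i w) theta_star <=
      loglik K psi x0 h (fun i => X i w) (theta_star + (theta_tilde w - theta_star)).
    by rewrite addrC subrK.
  have [v vr] := deviation_grad_ge mK K0 bK cK mpsi bpsi h0 Dpd DD L0 r00 delta2 ru Lw.
  rewrite -/(G w) -[G w](mulKVmx Vu) -/(Y w) dotC dot_mulmx sV dotC => hv.
  (* Condition (I) applied to [v], with [|Dn v| = r0]. *)
  have Vv : enorm (Vn *m v) <= a * r0.
    rewrite -(@ler_pXn2r _ 2) ?nnegrE ?enorm_ge0 ?(ltW ar0)//.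
    rewrite -qform_sqr// (le_trans (condI v))// exprMn -vr -qform_sqr// DD.
    by rewrite !qformE -scalemxAl dotZr.
  have := dot_le (Y w) (Vn *m v).
  have -> : enorm (Z w) = enorm (Y w) / nu0.
    by rewrite enormZ ger0_norm ?invr_ge0 ?(ltW nu00)// mulrC.
  rewrite ler_pdivlMr// -/S => hd.
  have h1 : 5 / 12 * r0 ^+ 2 <= enorm (Y w) * (a * r0).
    by rewrite (le_trans hv)// (le_trans hd)// ler_wpM2l ?enorm_ge0.
  have : r0 * a * (5 / 3 * S * nu0) <= r0 * a * enorm (Y w).
    move: h1; rewrite (_ : 5 / 12 * r0 ^+ 2 = r0 * a * (5 / 3 * S * nu0)).
      by move=> h1; rewrite (le_trans h1)//; lra.
    by rewrite expr2 {2}r0E; field.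
  by rewrite ler_pM2l// mulr_gt0.
Qed.
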